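(* There is a strongly polynomial time algorithm that, given a set $S\subseteq\{0,1\}^n$ presented by a membership oracle, a point $x\in S$, $w\in\mathbb{Z}^n$, and a finite set $E\subset\mathbb{Z}^n$ covering all edge-directions of the polytope $\mathrm{conv}(S)$, with input encoded as $[n,|E|;\langle x,w,E\rangle]$, provides an optimal solution $x^*\in S$ to the linear combinatorial optimization problem $\max\{wz:z\in S\}$.
   Context: For $w,z\in\mathbb{R}^n$, $wz:=\sum_{i=1}^n w_iz_i$. A membership oracle for $S\subseteq\mathbb{Z}^n$ is one that, queried on $x\in\mathbb{Z}^n$, asserts whether or not $x\in S$. A direction of an edge ($1$-dimensional face) $[u,v]$ of a polytope is any nonzero scalar multiple of $u-v$; a set $E$ covers all edge-directions of a polytope if it contains a direction of each of its edges. Complexity conventions (standard Turing machine model). The binary length of $z\in\mathbb{Z}$ is $\langle z\rangle:=1+\lceil\log_2(|z|+1)\rceil$; the length of a vector or a finite set is the sum of the lengths of its entries or elements. A square-bracketed expression lists all input objects affecting the running time, with objects inside $\langle\cdot\rangle$ measured by binary length and other objects by unary length (the unary length of $z\in\mathbb Z$ is $|z|+1$). In an encoding $[\text{left};\text{right}]$, the entire input is described on the right and a special part of it on the left. An oracle algorithm is strongly polynomial time if its running time (including the number of oracle queries) is polynomial in the length of the right part, and in addition the number of arithmetic operations (additions, subtractions, multiplications, divisions, comparisons, and oracle queries) it performs is polynomial in the left part. *)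

(* Defs.v *)
From HB Require Import structures.
From mathcomp Require Import all_boot all_order all_algebra.
From mathcomp Require Import boolp classical_sets reals convex.

Set Implicit Arguments.
Unset Strict Implicit.
Unset Printing Implicit Defensive.

Import Order.TTheory GRing.Theory Num.Theory.

Local Open Scope classical_set_scope.
Local Open Scope ring_scope.

Definition dot (R : pzRingType) (n : nat) (w z : 'rV[R]_n) : R :=
  \sum_(i < n) w 0 i * z 0 i.

Definition zero_one (n : nat) : set 'rV[int]_n :=
  [set z | forall i, z 0 i = 0 \/ z 0 i = 1].
Arguments zero_one n : clear implicits.

Definition embed (R : pzRingType) (n : nat) (z : 'rV[int]_n) : 'rV[R]_n :=
  map_mx intr z.
Arguments embed R {n} z.

Section Polytopes.
Variables (R : realType) (n : nat).
Implicit Types (P F A : set 'rV[R]_n) (c u v d : 'rV[R]_n).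

Definition conv_hull A : set 'rV[R]_n := smallest (@convex_set R 'rV[R]_n) A.

Definition segment u v : set 'rV[R]_n :=
  [set (1 - t) *: u + t *: v | t in [set t : R | 0 <= t <= 1]].

(* The case c = 0 gives P itself; the empty face is left out. *)
Definition nonempty_face P F : Prop :=
  F !=set0 /\
  exists c, F = [set y | P y /\ forall z, P z -> dot c z <= dot c y].

Definition edge P u v : Prop := u <> v /\ nonempty_face P (segment u v).

Definition direction_of u v d : Prop := exists2 a : R, a != 0 & d = a *: (u - v).

Definition covers_edge_directions P (E : seq 'rV[int]_n) : Prop :=
  forall u v, edge P u v -> exists2 e, e \in E & direction_of u v (embed R e).

End Polytopes.

Definition int_length (z : int) : nat := (1 + up_log 2 (`|z| + 1))%N.

Definition rat_length (q : rat) : nat :=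
  (int_length (numq q) + int_length (denq q))%N.

Definition vec_length (n : nat) (z : 'rV[int]_n) : nat :=
  (\sum_(i < n) int_length (z 0%R i))%N.

Definition set_length (n : nat) (E : seq 'rV[int]_n) : nat :=
  (\sum_(e <- E) vec_length e)%N.

Definition unary_length (k : nat) : nat := k.+1.

(* Algorithms are programs of a random access machine over the rationals, with *)
(* exact arithmetic and no rounding operation, and with an oracle for a set of *)
(* integer points.  The machine has registers, named directly by instructions, *)
(* and a memory, reached only through an address held in a register.           *)

Inductive arith := Add | Sub | Mul | Div.

Inductive instr :=
  | Const of nat & int           (* Const d z   : r_d := z                     *)
  | Move of nat & nat            (* Move d a    : r_d := r_a                   *)
  | Read of nat & nat            (* Read d a    : r_d := mem[r_a]              *)
  | Write of nat & nat           (* Write a b   : mem[r_a] := r_b              *)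
  | Arith of arith & nat & nat & nat  (* Arith o d a b : r_d := r_a o r_b      *)
  | JumpLe of nat & nat & nat    (* JumpLe a b l : if r_a <= r_b then goto l   *)
  | Jump of nat                  (* Jump l      : goto l                       *)
  | Query of nat & nat.          (* Query d a   : r_d := 1 if the vector       *)
                                 (* mem[r_a], ..., mem[r_a + n - 1] is in S,   *)
                                 (* else 0                                     *)

Definition program := seq instr.

(* [time] accumulates the running time under the logarithmic cost criterion:   *)
(* each instruction is charged the binary length of all numbers (addresses     *)
(* included) it handles, which determines Turing machine time up to a          *)
(* polynomial.  [nops] counts arithmetic operations, comparisons and queries.  *)
Record config := Config {
  pc : nat;
  regs : nat -> rat;
  memory : nat -> rat;
  time : nat;
  nops : nat }.

Definition upd (f : nat -> rat) (a : nat) (q : rat) : nat -> rat :=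
  fun b => if b == a then q else f b.

Definition address (q : rat) : option nat :=
  if q \is a Num.nat then Some (Num.truncn q) else None.

Definition eval_arith (o : arith) (a b : rat) : option rat :=
  match o with
  | Add => Some (a + b)
  | Sub => Some (a - b)
  | Mul => Some (a * b)
  | Div => if b == 0 then None else Some (a / b)
  end.

Section Machine.
Variables (n : nat) (S : set 'rV[int]_n).

Definition window (m : nat -> rat) (A : nat) : 'rV[rat]_n :=
  \row_(i < n) m (A + i)%N.

(* The oracle accepts only integer vectors. *)
Definition ask (q : 'rV[rat]_n) : option bool :=
  if [forall i, q 0 i \is a Num.int]
  then Some (map_mx Num.floor q \in S) else None.

(* [None]: either the program has ended (see [halted]) or the instruction      *)
(* cannot be carried out (division by 0, address not a natural number, query   *)
(* on a non-integer vector).                                                   *)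
Definition step (p : program) (c : config) : option config :=
  let: Config pc r m t k := c in
  match onth p pc with
  | None => None
  | Some i =>
    match i with
    | Const d z =>
        Some (Config pc.+1 (upd r d z%:~R) m (t + rat_length z%:~R) k)
    | Move d a =>
        Some (Config pc.+1 (upd r d (r a)) m (t + rat_length (r a)) k)
    | Read d a =>
        obind (fun A => Some
          (Config pc.+1 (upd r d (m A)) m
                  (t + rat_length (r a) + rat_length (m A)) k))
        (address (r a))
    | Write a b =>
        obind (fun A => Some
          (Config pc.+1 r (upd m A (r b))
                  (t + rat_length (r a) + rat_length (r b)) k))
        (address (r a))
    | Arith o d a b =>
        obind (fun q => Some
          (Config pc.+1 (upd r d q) m
                  (t + rat_length (r a) + rat_length (r b) + rat_length q) k.+1))
        (eval_arith o (r a) (r b))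
    | JumpLe a b l =>
        Some (Config (if r a <= r b then l else pc.+1) r m
                     (t + rat_length (r a) + rat_length (r b)) k.+1)
    | Jump l => Some (Config l r m t.+1 k)
    | Query d a =>
        obind (fun A =>
          obind (fun ans : bool => Some
            (Config pc.+1 (upd r d ans%:R) m
                    (t + rat_length (r a)
                       + \sum_(i < n) rat_length (window m A 0%R i) + 1)%N k.+1))
          (ask (window m A)))
        (address (r a))
    end
  end.

Definition run (p : program) (j : nat) (c : config) : option config :=
  iter j (obind (step p)) (Some c).

Definition halted (p : program) (c : config) : Prop := (size p <= pc c)%N.

Definition halts_in (p : program) (c c' : config) : Prop :=
  exists2 j, run p j c = Some c' & halted p c'.

End Machine.

Definition entries (n : nat) (z : 'rV[int]_n) : seq int :=
  [seq z 0 i | i <- enum 'I_n].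

(* Initially registers 0 and 1 hold n and |E|, the memory holds x, w and the   *)
(* elements of E one after the other, and everything else is 0.                *)
Definition initial (n : nat) (x w : 'rV[int]_n) (E : seq 'rV[int]_n) : config :=
  let input := entries x ++ entries w ++ flatten [seq entries e | e <- E] in
  {| pc := 0;
     regs := fun a => (nth 0%N [:: n; size E] a)%:R;
     memory := fun a => (nth 0%Z input a)%:~R;
     time := 0;
     nops := 0 |}.

(* The output is read off the first n memory cells. *)
Definition outputs (n : nat) (c : config) (y : 'rV[int]_n) : Prop :=
  window n (memory c) 0 = embed rat y.

Definition optimal (n : nat) (S : set 'rV[int]_n) (w y : 'rV[int]_n) : Prop :=
  S y /\ forall z, S z -> dot w z <= dot w y.

Definition left_length (n : nat) (E : seq 'rV[int]_n) : nat :=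
  (unary_length n + unary_length (size E))%N.

Definition right_length (n : nat) (x w : 'rV[int]_n) (E : seq 'rV[int]_n) : nat :=
  (vec_length x + vec_length w + set_length E)%N.

(* Main.v *)
(* The algorithm follows the shadow path of the pencil of objectives           *)
(* c + lambda w, lambda >= 0, where c_i = +-B^i has the signs making x its      *)
(* unique maximiser on the cube and B is so large that two directions in        *)
(* {-1,0,1}^n with positive w-value and equal ratio - c d / w d coincide.       *)
(* A vertex z adjacent to x along e is obtained from x by flipping the support  *)
(* of e, so the neighbours of x are found with |E| queries.  Moving to the      *)
(* w-improving neighbour of least ratio keeps the current point the unique      *)
(* maximiser of c + lambda w for a lambda just above that ratio.  The ratios    *)
(* met increase strictly and all are ratios of elements of E, so there are at   *)
(* most |E| moves; when no neighbour improves, the point is optimal.            *)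

Require Import Defs.
From HB Require Import structures.
From mathcomp Require Import all_boot all_order all_algebra.
From mathcomp Require Import boolp classical_sets reals interval_inference convex.
From mathcomp Require Import zify lra ring.

Set Implicit Arguments.
Unset Strict Implicit.
Unset Printing Implicit Defensive.

Import Order.TTheory GRing.Theory Num.Theory.

Local Open Scope classical_set_scope.
Local Open Scope ring_scope.

(** * Edges of 0/1 polytopes and the pivot step *)

(** If exactly two points x, y of S maximise some linear functional, then [x, y] is an edge
    ([edge_of_functional]), so some e in E is a multiple of y - x; as both are 0/1 points, y must be
    x flipped on the support of e ([covered_neighbor]). The functional used is c + lambda w at the
    first lambda where x stops being the unique maximiser. That lambda is the least [ratio] over all
    improving points of S, and genericity of c ([weights_base_generic]) makes it attained only once.
    So a minimum over a possibly exponential set is found among |E| flips, each tested by one query.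
    The same argument certifies optimality: an improving point anywhere in S forces an improving
    flip. [pivot_step] also shows that the ratio of e is passed for good, whence at most |E| moves.

    The number of machine steps is bounded by a polynomial in n and |E|. Numbers stay short because
    nothing accumulates over the moves: x is flipped in place, lambda is never stored, and only c,
    sums of at most n of its entries or of those of w, and single quotients are formed. The entries
    of c are powers of B up to sign and have quadratic bit length. The logic [wp] bounds steps while
    keeping every number within a fixed length, so that time is at most steps times [step_cost]. *)

Section Dot.
Variables (R : pzRingType) (n : nat).
Implicit Types (a : R) (u v w : 'rV[R]_n).

Lemma dotDr w u v : dot w (u + v) = dot w u + dot w v.
Proof. by rewrite /dot -big_split; apply: eq_bigr => i _; rewrite mxE mulrDr. Qed.

Lemma dotNr w v : dot w (- v) = - dot w v.
Proof. by rewrite /dot -sumrN; apply: eq_bigr => i _; rewrite mxE mulrN. Qed.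

Lemma dotBr w u v : dot w (u - v) = dot w u - dot w v.
Proof. by rewrite dotDr dotNr. Qed.

Lemma dotDl u v w : dot (u + v) w = dot u w + dot v w.
Proof. by rewrite /dot -big_split; apply: eq_bigr => i _; rewrite mxE mulrDl. Qed.

Lemma dotZl a u w : dot (a *: u) w = a * dot u w.
Proof. by rewrite /dot mulr_sumr; apply: eq_bigr => i _; rewrite mxE mulrA. Qed.

End Dot.

Lemma dotZr (R : comPzRingType) n w (a : R) (v : 'rV_n) :
  dot w (a *: v) = a * dot w v.
Proof. by rewrite /dot mulr_sumr; apply: eq_bigr => i _; rewrite mxE mulrCA. Qed.

Lemma dot_embed (R : realType) n (w z : 'rV[int]_n) :
  dot (embed R w) (embed R z) = (dot w z)%:~R.
Proof. by rewrite /dot (raddf_sum (intr : int -> R)); apply: eq_bigr => i _; rewrite !mxE -intrM. Qed.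

Lemma embed_inj (R : realType) n : injective (@embed R n).
Proof.
move=> u v /rowP uv; apply/rowP => i; move: (uv i).
by rewrite !mxE => /intr_inj.
Qed.

Lemma convex_setP (R : realType) n (A : set 'rV[R]_n) :
  @convex_set R 'rV[R]_n A <->
  forall u v t, 0 <= t <= 1 -> A u -> A v -> A ((1 - t) *: u + t *: v).
Proof.
split=> [cA u v t /andP[t0 t1] Au Av|cA u v t].
  have := cA v u (Itv01 t0 t1); rewrite !inE => /(_ Av Au).
  by rewrite addrC.
rewrite !inE => Au Av; have := cA v u t%:num; rewrite ge0 le1 => /(_ isT Av Au).
by rewrite addrC.
Qed.

Section EdgeOfFace.
Variables (R : realType) (n : nat) (S : set 'rV[int]_n) (x y f : 'rV[int]_n).
Let P := conv_hull (embed R @` S).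

(** The segment together with the open half-space below the common value of f is convex and contains
    S, hence contains the hull. So f attains its maximum on the hull exactly along the segment. *)
Lemma edge_of_functional : S x -> S y -> x <> y -> dot f y = dot f x ->
  (forall z, S z -> z <> x -> z <> y -> dot f z < dot f x) ->
  edge P (embed R x) (embed R y).
Proof.
move=> Sx Sy xy fyx flt; split; first by move=> /embed_inj.
set X := embed R x; set Y := embed R y; set F := embed R f.
have FYX : dot F Y = dot F X by rewrite !dot_embed fyx.
have Fseg t : dot F ((1 - t) *: X + t *: Y) = dot F X.
  by rewrite dotDr !dotZr FYX -mulrDl subrK mul1r.
have XP : P X by apply: sub_gen_smallest; exists x.
have YP : P Y by apply: sub_gen_smallest; exists y.
have segP : segment X Y `<=` P.
  move=> _ [t /= /andP[t0 t1] <-] A /= [convA SA].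
  by move/convex_setP: convA => convA; apply: convA; rewrite ?t0//; apply: SA; [exists x|exists y].
have PG : P `<=` [set p | segment X Y p \/ dot F p < dot F X].
  apply: smallest_sub; last first.
    move=> _ [z Sz <-] /=; have [->|/eqP zx] := eqVneq z x.
      by left; exists 0; rewrite /= ?lexx ?ler01// subr0 scale1r scale0r addr0.
    have [->|/eqP zy] := eqVneq z y.
      by left; exists 1; rewrite /= ?lexx ?ler01// subrr scale0r scale1r add0r.
    by right; rewrite !dot_embed ltr_int; exact: flt.
  apply/convex_setP => u v t /andP[t0 t1] /= uG vG; rewrite dotDr !dotZr.
  have FG p : segment X Y p \/ dot F p < dot F X -> dot F p <= dot F X.
    by case=> [[s _ <-]|/ltW//]; rewrite Fseg.
  have [t00|tn0] := eqVneq t 0; first by rewrite t00 subr0 scale1r scale0r addr0 mul1r mul0r addr0.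
  have [t11|tn1] := eqVneq t 1; first by rewrite t11 subrr scale1r scale0r add0r mul1r mul0r add0r.
  have tp : 0 < t by rewrite lt_neqAle eq_sym tn0.
  have tq : 0 < 1 - t by rewrite subr_gt0 lt_neqAle tn1.
  case: uG vG => [[s /= /andP[s0 s1] <-]|ult] [[r /= /andP[r0 r1] <-]|vlt].
  - left; exists ((1 - t) * s + t * r).
      rewrite /= addr_ge0 ?mulr_ge0 ?(ltW tq)//=; nra.
    by apply/rowP => i; rewrite !mxE; ring.
  - right; rewrite Fseg; nra.
  - right; rewrite Fseg; nra.
  - right; nra.
split; first by exists X; exists 0; rewrite /= ?lexx ?ler01// subr0 scale1r scale0r addr0.
exists F; apply/seteqP; split => [p pXY|p [/= Pp pmax]].
  split; first exact: segP.
  case: pXY => t _ <- z /PG /=; rewrite Fseg => -[[s _ <-]|/ltW//].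
  by rewrite Fseg.
by case: (PG _ Pp) => // /lt_geF; rewrite pmax.
Qed.
End EdgeOfFace.

(* The only candidate for a point of the cube x + a e with a <> 0. *)
Definition flip n (x e : 'rV[int]_n) : 'rV[int]_n :=
  \row_i (if e 0 i == 0 then x 0 i else 1 - x 0 i).

(** The entries of x - y are 0, 1 or -1 and not all 0, so the real factor is, up to sign, an entry
    of e and thus an integer. The support of e is then the set where x and y differ, and there y_i
    can only be 1 - x_i. *)
Lemma covered_neighbor (R : realType) n (S : set 'rV[int]_n) E x y :
  covers_edge_directions (conv_hull (embed R @` S)) E ->
  zero_one n x -> zero_one n y -> x <> y ->
  edge (conv_hull (embed R @` S)) (embed R x) (embed R y) ->
  exists e a, [/\ e \in E, a != 0, e = a *: (y - x) & y = flip x e].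
Proof.
move=> covE x01 y01 xy /covE[e eE [a a0 /rowP ea]].
have {}ea i : (e 0 i)%:~R = a * (x 0 i - y 0 i)%:~R.
  by move: (ea i); rewrite !mxE intrD mulrNz.
have [i xyi] : exists i, x 0 i != y 0 i.
  apply/existsP; apply: contra_notT xy => /existsPn xy; apply/rowP => i.
  by apply/eqP; move: (xy i); rewrite negbK.
have [b ab] : exists b : int, a = b%:~R.
  have := ea i; case: (x01 i) (y01 i) xyi => -> [] -> // _.
    by rewrite sub0r mulrN1 => /eqP; rewrite -eqr_oppLR => /eqP <-; exists (- e 0 i); rewrite mulrNz.
  by rewrite subr0 mulr1 => <-; exists (e 0 i).
have eb : e = - b *: (y - x).
  apply/rowP => j; rewrite !mxE; apply: (@intr_inj R).
  by rewrite ea ab -intrM; congr (_%:~R); ring.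
have b0 : b != 0 by move: a0; rewrite ab intr_eq0.
exists e, (- b); split=> //; first by rewrite oppr_eq0.
apply/rowP => j; rewrite eb !mxE mulf_eq0 oppr_eq0 (negPf b0) /=.
by case: (x01 j) (y01 j) => -> [] ->.
Qed.

Lemma argmin_zero_one n (S : set 'rV[int]_n) (F : 'rV[int]_n -> rat) z0 :
  S `<=` zero_one n -> S z0 -> exists2 y, S y & forall z, S z -> F y <= F z.
Proof.
move=> S01 Sz0.
pose pt (b : {ffun 'I_n -> bool}) : 'rV[int]_n := \row_i (b i)%:R.
have ptK z : S z -> z = pt [ffun i => z 0 i == 1].
  move=> /S01 z01; apply/rowP => i; rewrite !mxE ffunE.
  by case: (z01 i) => ->.
case: (@Order.TotalTheory.arg_minP _ _ _ [ffun i => z0 0 i == 1]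
    (fun b => `[< S (pt b) >]) (F \o pt)) => [|b /asboolP Sb bmin].
  by apply/asboolP; rewrite -ptK.
exists (pt b) => // z Sz; rewrite (ptK z Sz); apply: bmin.
by apply/asboolP; rewrite -ptK.
Qed.

(** The lambda for which c + lambda w is constant along d, provided w d is nonzero. *)
Definition ratio n (c w d : 'rV[int]_n) : rat := - (dot c d)%:~R / (dot w d)%:~R.

Lemma ratioZ n (c w d : 'rV[int]_n) a : a != 0 -> ratio c w (a *: d) = ratio c w d.
Proof.
move=> a0; rewrite /ratio !dotZr !intrM -mulrN -mulf_div divff ?mul1r//.
by rewrite intr_eq0.
Qed.

Lemma ratio_le n (c w d d' : 'rV[int]_n) : 0 < dot w d -> 0 < dot w d' ->
  (ratio c w d <= ratio c w d') = (dot c d' * dot w d <= dot c d * dot w d').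
Proof.
move=> wd wd'; rewrite /ratio ler_pdivrMr ?ltr0z// mulrAC ler_pdivlMr ?ltr0z//.
by rewrite !mulNr lerN2 -!intrM ler_int.
Qed.

Lemma count_ltn (T : eqType) (a1 a2 : pred T) (s : seq T) x :
  subpred a1 a2 -> x \in s -> a2 x -> ~~ a1 x -> (count a1 s < count a2 s)%N.
Proof.
move=> a12 + a2x a1x; elim: s => //= y s IHs; rewrite inE => /predU1P[<-|/IHs].
  by rewrite a2x (negPf a1x) ltnS; apply: sub_count.
by move=> lt12; rewrite -addnS leq_add//; case: (a1 y) (a12 y) => // ->.
Qed.

Section Pivot.
Variables (R : realType) (n : nat) (S : set 'rV[int]_n) (c w : 'rV[int]_n).
Variable E : seq 'rV[int]_n.
Hypothesis S01 : S `<=` zero_one n.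
Hypothesis covE : covers_edge_directions (conv_hull (embed R @` S)) E.
Hypothesis gen : forall x y z, S x -> S y -> S z ->
  0 < dot w (y - x) -> 0 < dot w (z - x) ->
  dot c (y - x) * dot w (z - x) = dot c (z - x) * dot w (y - x) -> y = z.

(** The sign of w e is left free: e may point from the new vertex back to the old one, and [ratio]
    does not change under scaling. *)
Let ahead (q : rat) e := (dot w e != 0) && (q < ratio c w e).

(* The point x is the unique maximiser for lambda = a / b, and at most k ratios *)
(* of elements of E exceed lambda.                                              *)
Definition pivot_state (k : nat) (x : 'rV[int]_n) : Prop :=
  exists a b : int, [/\ 0 < b, S x,
    forall z, S z -> z <> x -> dot (b *: c + a *: w) (z - x) < 0 &
    (count (ahead (a%:~R / b%:~R)) E <= k)%N].

(** As lambda grows from a / b, the point y of least ratio is the first to catch up with x. At the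
    tie the objective singles out the edge [x, y]; slightly later y alone is optimal. *)
Lemma pivot_step k x z0 : pivot_state k x -> S z0 -> 0 < dot w (z0 - x) ->
  exists y e, [/\ e \in E, y = flip x e, S y, 0 < dot w (y - x) &
   (forall z, S z -> 0 < dot w (z - x) -> z <> y ->
      ratio c w (y - x) < ratio c w (z - x)) /\
   exists2 k', (k' < k)%N & pivot_state k' y].
Proof.
move=> [a [b [b0 Sx xmax cnt]]] Sz0 wz0.
have [y [Sy wy ymin]] : exists y, [/\ S y, 0 < dot w (y - x) &
    forall z, S z -> 0 < dot w (z - x) -> ratio c w (y - x) <= ratio c w (z - x)].
  have S'01 : [set z | S z /\ 0 < dot w (z - x)] `<=` zero_one n.
    by move=> z /= [/S01].
  have [y [Sy wy] ymin] := argmin_zero_one (fun z => ratio c w (z - x)) S'01 (conj Sz0 wz0).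
  by exists y; split=> // z Sz wz; apply: ymin.
(* Genericity turns the minimum into a strict one. *)
have {}ymin z : S z -> 0 < dot w (z - x) -> z <> y ->
    ratio c w (y - x) < ratio c w (z - x).
  move=> Sz wz zy; rewrite ltNge; apply: contra_notN zy => zley.
  have := ymin z Sz wz; move: zley; rewrite !ratio_le// => h1 h2.
  by apply/esym/(gen Sx) => //; apply/eqP; rewrite eq_le h1 h2.
have yx : y <> x by move=> yx; move: wy; rewrite yx subrr -(scale0r 0) dotZr mul0r ltxx.
set h := b *: c + a *: w in xmax.
(* f is proportional to c + lambda w at lambda = ratio c w (y - x).             *)
pose f := dot w (y - x) *: h - dot h (y - x) *: w.
have hy := xmax y Sy yx.
have flt z : S z -> z <> x -> z <> y -> dot f (z - x) < 0.
  move=> Sz zx zy; rewrite /f -scaleNr dotDl !dotZl.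
  have hz := xmax z Sz zx.
  (* If w does not grow towards z, the [h] term is negative and the [w] term is at most 0. Otherwise
     strict minimality of the ratio decides. *)
  have [wz|wz] := ltP 0 (dot w (z - x)); last first.
    by rewrite -[ltRHS]addr0 ltr_leD ?pmulr_rlt0 ?pmulr_rle0// oppr_gt0.
  have := ymin z Sz wz zy; rewrite ltNge ratio_le// -ltNge => yz.
  rewrite /h !dotDl !dotZl.
  rewrite (_ : _ + _ = b * (dot c (z - x) * dot w (y - x) -
    dot c (y - x) * dot w (z - x))); last by ring.
  by rewrite pmulr_rlt0// subr_lt0.
have fy : dot f (y - x) = 0.
  by rewrite /f -scaleNr dotDl !dotZl; ring.
have ed : edge (conv_hull (embed R @` S)) (embed R x) (embed R y).
  apply: (@edge_of_functional R _ _ _ _ f) => //; first by move=> /esym.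
    by apply/eqP; rewrite -subr_eq0 -dotBr fy.
  by move=> z Sz zx zy; rewrite -subr_lt0 -dotBr flt.
have [e [s [eE s0 es yflip]]] := covered_neighbor covE (S01 Sx) (S01 Sy) (nesym yx) ed.
(* The new objective is K f + w, i.e. lambda moved past the ratio of y - x by   *)
(* 1 / b', with K so large that only x and y matter.                            *)
exists y, e; split=> //; split=> //.
pose K : int := 1 + \sum_(i < n) `|w 0 i|.
have wK z : S z -> dot w (z - y) < K.
  move=> Sz; rewrite /K [ltRHS]addrC ltzD1; apply: ler_sum => i _; rewrite !mxE.
  case: (S01 Sz i) (S01 Sy i) => -> [] ->;
    by rewrite ?subrr ?subr0 ?sub0r ?mulr0 ?mulr1 ?mulrN1 ?normr_ge0 ?ler_norm// -normrN ler_norm.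
have K0 : 0 < K by rewrite /K [ltRHS]addrC ltzD1; apply: sumr_ge0.
pose a' := 1 - K * b * dot c (y - x).
pose b' := K * b * dot w (y - x).
have b'0 : 0 < b' by rewrite !mulr_gt0.
have h'E : b' *: c + a' *: w = K *: f + w.
  by apply/rowP => i; rewrite /f /h /a' /b' !mxE !dotDl !dotZl; ring.
have ratio_e : ratio c w e = ratio c w (y - x) by rewrite es ratioZ.
have lt1 : a%:~R / b%:~R < ratio c w (y - x).
  rewrite /ratio ltr_pdivrMr ?ltr0z// mulrAC ltr_pdivlMr ?ltr0z//.
  rewrite mulNr -!intrM -mulrNz ltr_int.
  by rewrite -subr_lt0 opprK addrC [_ * b]mulrC -!dotZl -dotDl.
have lt2 : ratio c w (y - x) < a'%:~R / b'%:~R.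
  rewrite /ratio ltr_pdivrMr ?ltr0z// mulrAC ltr_pdivlMr ?ltr0z//.
  rewrite mulNr -!intrM -mulrNz ltr_int /a' /b' -subr_gt0.
  by rewrite (_ : _ - _ = dot w (y - x)) //; ring.
exists (count (ahead (a'%:~R / b'%:~R)) E).
  (* The ratio of e lies strictly between the old and the new lambda, so e itself drops out of the
     count. *)
  have we : dot w e != 0 by rewrite es dotZr mulf_neq0// gt_eqF.
  apply: leq_trans cnt; apply: (count_ltn _ eE).
  - by move=> e' /andP[we' /(lt_trans lt2)/(lt_trans lt1)]; rewrite /ahead we'.
  - by rewrite /ahead we ratio_e.
  - by rewrite /ahead ratio_e ltNge (ltW lt2) andbF.
exists a', b'; split=> // z Sz zy; rewrite h'E dotDl dotZl.
have [zx|/eqP zx] := eqVneq z x.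
  have -> : z - y = - (y - x) by rewrite opprB zx.
  by rewrite !dotNr fy oppr0 mulr0 add0r oppr_lt0.
have := wK z Sz; have := flt z Sz zx zy.
have -> : dot f (z - y) = dot f (z - x).
  by move: fy; rewrite !dotBr => /subr0_eq ->.
move=> fz zK; rewrite -ltrBrDr sub0r.
(* A negative value of the integral f is at most -1, and K outweighs any gain in w. *)
have : K * dot f (z - x) <= K * -1 by rewrite ler_pM2l//; lia.
by rewrite mulrN1 => /le_lt_trans; apply; rewrite ltrN2.
Qed.

End Pivot.

(** * A generic objective from powers of a large base *)

Lemma digits_bound (F : nat -> int) (B : int) k :
  (forall i, (i < k)%N -> `|F i| < B) -> `|\sum_(i < k) F i * B ^+ i| < B ^+ k.
Proof.
elim: k => [|k IHk] FB; first by rewrite big_ord0 normr0 expr0.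
have B0 : 0 < B by apply: le_lt_trans (FB k _).
rewrite big_ord_recr /= exprS; apply: le_lt_trans (ler_normD _ _) _.
have {}IHk : `|\sum_(i < k) F i * B ^+ i| < B ^+ k.
  by apply: IHk => i ik; apply: FB; apply: ltnW.
rewrite normrM (gtr0_norm (exprn_gt0 _ B0)).
have : `|F k| * B ^+ k <= (B - 1) * B ^+ k.
  by rewrite ler_pM2r ?exprn_gt0// lerBrDr lezD1; apply: FB.
by rewrite mulrBl mul1r; lra.
Qed.

(** By [digits_bound] the lower digits sum to less than B^k in absolute value, so they cannot cancel
    a nonzero leading digit. *)
Lemma digits_eq0 (F : nat -> int) (B : int) k :
  (forall i, (i < k)%N -> `|F i| < B) -> \sum_(i < k) F i * B ^+ i = 0 ->
  forall i, (i < k)%N -> F i = 0.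
Proof.
elim: k => // k IHk FB; rewrite big_ord_recr /= => S0.
have FBk i : (i < k)%N -> `|F i| < B by move=> ik; apply/FB/ltnW.
have B0 : 0 < B by apply: le_lt_trans (FB k _).
have Fk : F k = 0.
  have := digits_bound FBk; move/eqP: S0; rewrite addr_eq0 => /eqP ->.
  rewrite normrN normrM (gtr0_norm (exprn_gt0 _ B0)) -[ltRHS]mul1r.
  by rewrite ltr_pM2r ?exprn_gt0//; lia.
move: S0; rewrite Fk mul0r addr0 => S0 i; rewrite ltnS leq_eqVlt => /predU1P[->//|].
exact: IHk.
Qed.

Definition weights n (x : 'rV[int]_n) (B : int) : 'rV[int]_n :=
  \row_i ((x 0 i *+ 2 - 1) * B ^+ i).

(** Up to sign, the entries of v are the digits of the product in base B; [insub] only extends them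
    to all naturals. *)
Lemma weights_generic n (x v : 'rV[int]_n) B : zero_one n x ->
  (forall i, `|v 0 i| < B) -> dot (weights x B) v = 0 -> v = 0.
Proof.
move=> x01 vB; pose F i := if insub i is Some j then (x 0 j *+ 2 - 1) * v 0 j else 0.
have FE (j : 'I_n) : F j = (x 0 j *+ 2 - 1) * v 0 j by rewrite /F valK.
have sgn (j : 'I_n) : x 0 j *+ 2 - 1 = 1 \/ x 0 j *+ 2 - 1 = -1.
  by case: (x01 j) => ->; [right|left].
have -> : dot (weights x B) v = \sum_(i < n) F i * B ^+ i.
  by apply: eq_bigr => i _; rewrite FE !mxE mulrAC.
have FB i : (i < n)%N -> `|F i| < B.
  move=> ik; rewrite (FE (Ordinal ik)) normrM.
  by case: (sgn (Ordinal ik)) => ->; rewrite ?normrN normr1 mul1r.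
move=> /(digits_eq0 FB) F0; apply/rowP => j; rewrite mxE.
have := F0 j (ltn_ord j); rewrite FE; case: (sgn j) => ->; rewrite ?mul1r ?mulN1r.
- by apply.
- by move=> v0; apply/oppr_inj; rewrite oppr0; apply: v0.
Qed.

Lemma weights_max n (x z : 'rV[int]_n) B : 0 < B -> zero_one n x -> zero_one n z ->
  z <> x -> dot (weights x B) (z - x) < 0.
Proof.
move=> B0 x01 z01 zx.
have [i zxi] : exists i, z 0 i != x 0 i.
  apply/existsP; apply: contra_notT zx => /existsPn zx; apply/rowP => i.
  by apply/eqP; move: (zx i); rewrite negbK.
(* No coordinate contributes positively, and it contributes 0 only where z agrees with x; one
   disagreement makes the sum negative. *)
have t0 j : (weights x B) 0 j * (z - x) 0 j <= 0 ?= iff (z 0 j == x 0 j).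
  rewrite !mxE mulrAC; split.
    by rewrite pmulr_lle0 ?exprn_gt0//; case: (z01 j) (x01 j) => -> [] ->.
  by rewrite mulf_eq0 [_ ^+ _ == 0]gt_eqF ?exprn_gt0// orbF;
    case: (z01 j) (x01 j) => -> [] ->.
rewrite lt_neqAle; have := leif_sum (P := xpredT) (fun j _ => t0 j).
rewrite big1_eq => -[-> ->]; rewrite andbT.
by apply/forallPn; exists i; rewrite implyTb.
Qed.

(* Twice the square of a bound on all |w d| with d in {-1,0,1}^n. *)
Definition base n (w : 'rV[int]_n) : int := (1 + \sum_(i < n) w 0 i ^+ 2) ^+ 2 *+ 2.

(** Equality of the ratios says that c annihilates w(t - y) (z - y) - w(z - y) (t - y). Its entries
    are below [base w], so it vanishes; then z - y and t - y have the same support, which determines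
    a 0/1 point given y. *)
Lemma weights_base_generic n (x w y z t : 'rV[int]_n) :
  zero_one n x -> zero_one n y -> zero_one n z -> zero_one n t ->
  let c := weights x (base w) in
  0 < dot w (z - y) -> 0 < dot w (t - y) ->
  dot c (z - y) * dot w (t - y) = dot c (t - y) * dot w (z - y) -> z = t.
Proof.
move=> x01 y01 z01 t01 c wz wt ct.
(* Integers satisfy |w_i| <= w_i^2, so a sum of squares bounds w on differences of 0/1 points. *)
pose M := 1 + \sum_(i < n) w 0 i ^+ 2.
have M1 : 1 <= M by rewrite lerDl; apply: sumr_ge0 => i _; apply: sqr_ge0.
have dotM u : zero_one n u -> dot w (u - y) < M.
  move=> u01; rewrite /M [ltRHS]addrC ltzD1; apply: ler_sum => i _; rewrite !mxE.
  have : w 0 i <= w 0 i ^+ 2 /\ - w 0 i <= w 0 i ^+ 2 by nia.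
  case: (u01 i) (y01 i) => -> [] ->; 
  rewrite ?subrr ?subr0 ?sub0r ?mulr0 ?mulr1 ?mulrN1 ?sqr_ge0//; tauto.
have v0 : dot w (t - y) *: (z - y) - dot w (z - y) *: (t - y) = 0.
  apply: (@weights_generic _ x _ (base w)) => //; last first.
    by rewrite dotBr !dotZr mulrC ct mulrC subrr.
  have MB : M + M <= base w by rewrite /base -/M mulr2n; nia.
  have := dotM z z01; have := dotM t t01 => lt lz i; rewrite !mxE.
  apply: le_lt_trans (ler_normB _ _) _; apply: lt_le_trans MB.
  by rewrite !normrM (gtr0_norm wt) (gtr0_norm wz); case: (z01 i) (t01 i) (y01 i) => -> [] -> [] ->; rewrite /=; lia.
apply/rowP => i; move/rowP/(_ i): v0; rewrite !mxE.
set a := dot w (t - y) in wt *; set b := dot w (z - y) in wz *.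
by case: (z01 i) (t01 i) (y01 i) => -> [] -> [] ->; rewrite /=; lia.
Qed.

Lemma pivot_state_init n (S : set 'rV[int]_n) (x w : 'rV[int]_n) E :
  S `<=` zero_one n -> S x -> pivot_state S (weights x (base w)) w E (size E) x.
Proof.
move=> S01 Sx; exists 0, 1; split=> //; last exact: count_size.
move=> z Sz zx; rewrite scale1r scale0r addr0; apply: weights_max => //; try exact: S01.
rewrite /base pmulrn_lgt0// exprn_gt0// ltr_wpDr//.
by apply: sumr_ge0 => i _; apply: sqr_ge0.
Qed.

(** * Structured programs and their total correctness *)

Inductive cmd :=
  | Skip
  | Ins of instr
  | Seq of cmd & cmd
  | IfLe of nat & nat & cmd & cmd
  | WhileLt of nat & nat & cmd.

Fixpoint csize (c : cmd) : nat :=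
  match c with
  | Skip => 0
  | Ins _ => 1
  | Seq c1 c2 => (csize c1 + csize c2)%N
  | IfLe _ _ c1 c2 => (csize c2 + csize c1)%N.+2
  | WhileLt _ _ c1 => (csize c1).+2
  end.

(** Jump targets are absolute, so code depends on its position [o]. As [JumpLe] jumps when its test
    holds, the else branch comes first, and a loop exits on the reversed comparison. *)
Fixpoint compile (o : nat) (c : cmd) : program :=
  match c with
  | Skip => [::]
  | Ins i => [:: i]
  | Seq c1 c2 => compile o c1 ++ compile (o + csize c1)%N c2
  | IfLe a b c1 c2 =>
      JumpLe a b (o + (csize c2).+2)%N :: compile o.+1 c2 ++
      Jump (o + (csize c2 + csize c1).+2)%N :: compile (o + (csize c2).+2)%N c1
  | WhileLt a b c1 =>
      JumpLe b a (o + (csize c1).+2)%N :: compile o.+1 c1 ++ [:: Jump o]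
  end.

Lemma size_compile c o : size (compile o c) = csize c.
Proof.
elim: c o => //= [c1 IH1 c2 IH2|_ _ c1 IH1 c2 IH2|_ _ c1 IH1] o.
- by rewrite size_cat IH1 IH2.
- by rewrite size_cat /= IH1 IH2 addnS.
- by rewrite size_cat /= IH1 addn1.
Qed.

Section Logic.
Variables (n : nat) (S : set 'rV[int]_n) (L : nat).

(** Enough for a query (an address, n entries and 1), an arithmetic operation (three numbers) and a
    jump (1). *)
Definition step_cost : nat := ((n + 3) * L + 1)%N.

Definition bounded (f : nat -> rat) : Prop := forall a, (rat_length (f a) <= L)%N.

Lemma bounded_upd f d q : bounded f -> (rat_length q <= L)%N -> bounded (upd f d q).
Proof. by move=> bf qL a; rewrite /upd; case: ifP. Qed.

Definition post := (nat -> rat) -> (nat -> rat) -> Prop.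

(** Quantifying over the initial counters t and q lets postconditions speak of registers and memory
    alone. *)
Definition goes (p : program) (k a : nat) (r m : nat -> rat) (b : nat) (Q : post) :=
  forall t q, exists j c,
    [/\ run S p j (Config a r m t q) = Some c,
        (j <= k)%N, pc c = b, (time c <= t + j * step_cost)%N &
        (nops c <= q + j)%N /\ Q (regs c) (memory c)].

Lemma goes_refl p k a r m (Q : post) : Q r m -> goes p k a r m a Q.
Proof.
by move=> Qrm t q; exists 0%N, (Config a r m t q); rewrite /= !addn0.
Qed.

Lemma goes_trans p k1 k2 k a b e r m (Q1 Q : post) : (k1 + k2 <= k)%N ->
  goes p k1 a r m b Q1 ->
  (forall r' m', Q1 r' m' -> goes p k2 b r' m' e Q) -> goes p k a r m e Q.
Proof.
move=> lek g1 g2 t q; have [j1 [c1 [run1 le1 pc1 t1 [q1 Q1c]]]] := g1 t q.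
have [j2 [c2 [run2 le2 pc2 t2 [q2 Q2c]]]] := g2 _ _ Q1c (time c1) (nops c1).
exists (j2 + j1)%N, c2; split=> //; [|lia..|split=> //; lia].
by rewrite /run iterD -/(run S p j1 _) run1; case: (c1) pc1 run2 => /= ? ? ? ? ? ->.
Qed.

Lemma goes_step p k a r m b r' m' e (Q : post) :
  (forall t q, exists t' q', [/\ step S p (Config a r m t q) = Some (Config b r' m' t' q'),
     (t' <= t + step_cost)%N & (q' <= q.+1)%N]) ->
  goes p k b r' m' e Q -> goes p k.+1 a r m e Q.
Proof.
move=> st g; apply: (@goes_trans _ 1 k k.+1 _ b _ _ _ (fun r1 m1 => r1 = r' /\ m1 = m')).
- by rewrite add1n.
- move=> t q; have [t' [q' [E le1 le2]]] := st t q.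
  by exists 1%N, (Config b r' m' t' q'); split=> //=; rewrite ?mul1n ?addn1.
by move=> _ _ [-> ->].
Qed.

(* Running time is counted through the number of steps: all numbers stay within *)
(* length L, so that a step costs at most step_cost.                            *)
Definition wp (c : cmd) (k : nat) (Q : post) (r m : nat -> rat) : Prop :=
  bounded r -> bounded m -> forall pre suf,
  goes (pre ++ compile (size pre) c ++ suf) k (size pre) r m (size pre + csize c)%N
    (fun r' m' => [/\ bounded r', bounded m' & Q r' m']).

Lemma wp_post c k (Q1 Q2 : post) r m :
  (forall r' m', Q1 r' m' -> Q2 r' m') -> wp c k Q1 r m -> wp c k Q2 r m.
Proof.
move=> Q12 w br bm pre suf t q; have [j [d [? ? ? ? [? [? ? Q1d]]]]] := w br bm pre suf t q.
by exists j, d; do 2![split=> //]; split=> //; apply: Q12.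
Qed.

Lemma wp_leq c k1 k2 (Q : post) r m : (k1 <= k2)%N -> wp c k1 Q r m -> wp c k2 Q r m.
Proof.
move=> k12 w br bm pre suf t q; have [j [d [? jk ? ? ?]]] := w br bm pre suf t q.
by exists j, d; split=> //; apply: leq_trans jk k12.
Qed.

Lemma wp_skip k (Q : post) r m : Q r m -> wp Skip k Q r m.
Proof. by move=> Qrm br bm pre suf; rewrite addn0; apply: goes_refl. Qed.

Lemma wp_seq k1 k2 k c1 c2 (Q : post) r m : (k1 + k2 <= k)%N ->
  wp c1 k1 (wp c2 k2 Q) r m -> wp (Seq c1 c2) k Q r m.
Proof.
move=> lek w1 br bm pre suf /=.
apply: (goes_trans lek); first by rewrite -catA; apply: w1.
move=> r' m' [br' bm' w2]; have := w2 br' bm' (pre ++ compile (size pre) c1) suf.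
by rewrite size_cat size_compile -!catA addnA.
Qed.

Lemma onth_size_cat (T : Type) (s1 s2 : seq T) : onth (s1 ++ s2) (size s1) = onth s2 0.
Proof. by rewrite onth_cat ltnn subnn. Qed.

Lemma wp_ins i k (Q : post) r m r' m' :
  (forall p a t q, onth p a = Some i -> bounded r -> bounded m ->
     exists t' q', [/\ step S p (Config a r m t q) = Some (Config a.+1 r' m' t' q'),
     (t' <= t + step_cost)%N & (q' <= q.+1)%N]) ->
  (bounded r -> bounded m -> bounded r' /\ bounded m') -> Q r' m' ->
  wp (Ins i) k.+1 Q r m.
Proof.
move=> st b' Qr br bm pre suf; have [br' bm'] := b' br bm.
rewrite addn1; apply: (@goes_step _ _ _ _ _ (size pre).+1 r' m'); last exact: goes_refl.
by move=> t q; apply: st br bm; rewrite onth_size_cat.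
Qed.

Lemma wp_const k d z (Q : post) r m : (rat_length z%:~R <= L)%N ->
  Q (upd r d z%:~R) m -> wp (Ins (Const d z)) k.+1 Q r m.
Proof.
move=> zL; apply: wp_ins => [p a t q pa _ _|br bm].
  by rewrite /= pa; do 2!eexists; split=> //; rewrite /step_cost; nia.
by split=> //; apply: bounded_upd.
Qed.

Lemma wp_move k d a (Q : post) r m :
  Q (upd r d (r a)) m -> wp (Ins (Move d a)) k.+1 Q r m.
Proof.
apply: wp_ins => [p pa t q pE br _|br bm].
  rewrite /= pE; do 2!eexists; split=> //; rewrite /step_cost.
  by have := br a; nia.
by split=> //; apply: bounded_upd.
Qed.

Lemma address_nat a : address a%:R = Some a.
Proof. by rewrite /address natr_nat natrK. Qed.

Lemma wp_read k d a A (Q : post) r m : r a = A%:R ->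
  Q (upd r d (m A)) m -> wp (Ins (Read d a)) k.+1 Q r m.
Proof.
move=> rA; apply: wp_ins => [p pa t q pE br bm|br bm].
  rewrite /= pE rA address_nat /=; do 2!eexists; split=> //; rewrite /step_cost.
  by have := br a; have := bm A; rewrite rA; nia.
by split=> //; apply: bounded_upd.
Qed.

Lemma wp_write k a b A (Q : post) r m : r a = A%:R ->
  Q r (upd m A (r b)) -> wp (Ins (Write a b)) k.+1 Q r m.
Proof.
move=> rA; apply: wp_ins => [p pa t q pE br bm|br bm].
  rewrite /= pE rA address_nat /=; do 2!eexists; split=> //; rewrite /step_cost.
  by have := br a; have := br b; rewrite rA; nia.
by split=> //; apply: bounded_upd.
Qed.

Lemma wp_arith k o d a b v (Q : post) r m : eval_arith o (r a) (r b) = Some v ->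
  (rat_length v <= L)%N -> Q (upd r d v) m -> wp (Ins (Arith o d a b)) k.+1 Q r m.
Proof.
move=> ev vL; apply: wp_ins => [p pa t q pE br bm|br bm].
  rewrite /= pE ev /=; do 2!eexists; split=> //; rewrite /step_cost.
  by have := br a; have := br b; nia.
by split=> //; apply: bounded_upd.
Qed.

Lemma wp_query k d a A (x : 'rV[int]_n) (Q : post) r m : r a = A%:R ->
  window n m A = embed rat x -> (0 < L)%N ->
  (rat_length (x \in S)%:R <= L)%N ->
  Q (upd r d (x \in S)%:R) m -> wp (Ins (Query d a)) k.+1 Q r m.
Proof.
move=> rA mA L0 bL; have askE : ask S (window n m A) = Some (x \in S).
  rewrite /ask mA ifT; last by apply/forallP => i; rewrite mxE intr_int.
  by congr (Some (_ \in S)); apply/rowP => i; rewrite !mxE intrKfloor.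
apply: wp_ins => [p pa t q pE br bm|br bm].
  rewrite /= pE rA address_nat /= askE /=; do 2!eexists; split=> //; rewrite /step_cost.
  have : (\sum_(i < n) rat_length (window n m A 0%R i) <= n * L)%N.
    rewrite -[n in (n * L)%N]card_ord -sum_nat_const; apply: leq_sum => i _.
    by rewrite mxE.
  rewrite mulnDl; set s := (\sum_(i < n) _)%N; have := br a; rewrite rA; lia.
by split=> //; apply: bounded_upd.
Qed.

Lemma wp_if k a b c1 c2 (Q : post) r m :
  (r a <= r b -> wp c1 k Q r m) -> (r b < r a -> wp c2 k Q r m) ->
  wp (IfLe a b c1 c2) k.+2 Q r m.
Proof.
move=> w1 w2 br bm pre suf /=.
have st t : (t + rat_length (r a) + rat_length (r b) <= t + step_cost)%N.
  by rewrite /step_cost; have := br a; have := br b; nia.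
set J1 := JumpLe _ _ _; set J2 := Jump _.
set C2 := compile _.+1 c2; set C1 := compile _ c1.
case: (leP (r a) (r b)) => rab.
  apply: (@goes_step _ _ _ _ _ (size pre + (csize c2).+2)%N) => [t q|].
    by do 2!eexists; split; [rewrite /step onth_size_cat /= rab|exact: st|].
  have := w1 rab br bm (pre ++ J1 :: C2 ++ [:: J2]) suf.
  rewrite !size_cat /= size_cat /= size_compile addn1 -/C1.
  rewrite -catA /= -catA /= => g; rewrite -catA /=.
  move=> t q; have [j [d [? jk pcd ? ?]]] := g t q; exists j, d; split=> //; first by lia.
  by rewrite pcd; lia.
apply: (@goes_step _ _ _ _ _ (size pre).+1 r m) => [t q|].
  by do 2!eexists; split; [rewrite /step onth_size_cat /= leNgt rab|exact: st|].
have := w2 rab br bm (rcons pre J1) (J2 :: C1 ++ suf).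
rewrite size_rcons -/C2 cat_rcons => g; rewrite -catA cat_cons.
rewrite -addn1; apply: (goes_trans (leqnn _) g) => r' m' Q'.
have -> : ((size pre).+1 + csize c2)%N = size (pre ++ J1 :: C2).
  by rewrite size_cat /= size_compile addnS.
apply: (@goes_step _ 0 _ _ _ (size pre + (csize c2 + csize c1).+2)%N r' m');
  last exact: goes_refl.
move=> t q; do 2!eexists; split.
- rewrite /step (_ : pre ++ _ = (pre ++ J1 :: C2) ++ J2 :: C1 ++ suf) ?onth_size_cat//.
  by rewrite -catA.
- by rewrite /step_cost; lia.
- by [].
Qed.

(** The index of the invariant bounds the remaining iterations. Each costs two steps beyond the
    body, the test and the jump back; the strict inequality pays for the last test. *)
Lemma wp_while k K a b c (I : nat -> post) (Q : post) j r m :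
  (forall j r m, I j r m -> r a < r b ->
     wp c k (fun r' m' => exists2 j', (j' < j)%N & I j' r' m') r m) ->
  (forall j r m, I j r m -> r b <= r a -> Q r m) ->
  (j * k.+2 < K)%N -> I j r m -> wp (WhileLt a b c) K Q r m.
Proof.
move=> wI wQ; elim/ltn_ind: j K r m => j IHj K r m ltK Irm br bm pre suf /=.
have st t : (t + rat_length (r b) + rat_length (r a) <= t + step_cost)%N.
  by rewrite /step_cost; have := br a; have := br b; nia.
set J1 := JumpLe _ _ _; set J2 := Jump _; set C := compile _ c.
case: K ltK => // K ltK.
case: (leP (r b) (r a)) => rab.
  apply: (@goes_step _ _ _ _ _ (size pre + (csize c).+2)%N r m) => [t q|].
    by do 2!eexists; split; [rewrite /step onth_size_cat /= rab|exact: st|].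
  by apply: goes_refl; split=> //; apply: wQ Irm rab.
apply: (@goes_step _ _ _ _ _ (size pre).+1 r m) => [t q|].
  by do 2!eexists; split; [rewrite /step onth_size_cat /= leNgt rab|exact: st|].
have := wI _ _ _ Irm rab br bm (rcons pre J1) (J2 :: suf).
rewrite size_rcons -/C cat_rcons => g; rewrite -catA cat_cons.
(* At index 0 the body would have to reach a smaller index, so the loop cannot be entered. *)
case: j => [|j] in IHj ltK Irm g *.
  by have [? [? [_ _ _ _ [_ [_ _ []]]]]] := g 0%N 0%N.
apply: (goes_trans (k1 := k) (k2 := (K - k)%N) _ g); first by lia.
move=> r' m' [br' bm' [j' j'j I']].
have -> : (K - k = (K - k).-1.+1)%N by lia.
have -> : ((size pre).+1 + csize c)%N = size (pre ++ J1 :: C).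
  by rewrite size_cat /= size_compile addnS.
apply: (@goes_step _ _ _ _ _ (size pre) r' m').
  move=> t q; do 2!eexists; split.
  - rewrite /step (_ : pre ++ _ = (pre ++ J1 :: C) ++ J2 :: suf) ?onth_size_cat//.
    by rewrite -catA.
  - by rewrite /step_cost; lia.
  - by [].
have := IHj j' j'j (K - k)%N.-1 r' m' _ I' br' bm' pre suf; rewrite /= -/J1 -/J2 -/C.
rewrite -catA /=; apply; nia.
Qed.

End Logic.

(** * The program *)

(* A length bound for all quotients a / b of integers bounded by N. *)
Definition word (N : nat) : nat := (2 * (1 + up_log 2 (N + 1)))%N.

Lemma int_length_le (N : nat) z : `|z| <= N%:Z -> (int_length z <= 1 + up_log 2 (N + 1))%N.
Proof. by move=> zN; rewrite /int_length leq_add2l leq_up_log//; lia. Qed.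

(** Reduction to lowest terms only shrinks numerator and denominator. *)
Lemma rat_length_div (N : nat) (a b : int) : `|a| <= N%:Z -> `|b| <= N%:Z ->
  b != 0 -> (rat_length (a%:~R / b%:~R) <= word N)%N.
Proof.
rewrite /rat_length /word; case: divqP => [_ _ _ /eqP//|k q k0 aN bN kb0].
rewrite mul2n -addnn leq_add// int_length_le//.
  by apply: le_trans aN; rewrite normrM ler_peMl//; lia.
by apply: le_trans bN; rewrite normrM ler_peMl//; lia.
Qed.

Lemma rat_length_int (N : nat) z : (0 < N)%N -> `|z| <= N%:Z ->
  (rat_length z%:~R <= word N)%N.
Proof.
by move=> N0 zN; rewrite -[z%:~R]divr1 -[1]/(1%:~R) rat_length_div//; lia.
Qed.

Coercion Ins : instr >-> cmd.
Local Notation "a ;; b" := (Seq a b) (at level 61, right associativity).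

Section Wp.
Variables (n : nat) (S : set 'rV[int]_n) (N : nat).
Hypothesis N0 : (0 < N)%N.
Local Notation wp := (wp S (word N)).

Lemma wp_cons k c1 c2 Q r m : wp c1 1 (wp c2 k Q) r m -> wp (c1 ;; c2) k.+1 Q r m.
Proof. exact: wp_seq. Qed.

Lemma wp_consti k d (z : int) (Q : post) r m : `|z| <= N%:Z ->
  Q (upd r d z%:~R) m -> wp (Const d z) k.+1 Q r m.
Proof. by move=> zN; apply: wp_const; apply: rat_length_int. Qed.

Lemma wp_add k d a b (x y : int) (Q : post) r m : r a = x%:~R -> r b = y%:~R ->
  `|x + y| <= N%:Z -> Q (upd r d (x + y)%:~R) m -> wp (Arith Add d a b) k.+1 Q r m.
Proof.
move=> ra rb zN; apply: wp_arith; last exact: rat_length_int zN.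
by rewrite /= ra rb intrD.
Qed.

Lemma wp_addn k d a b (x y : nat) (Q : post) r m : r a = x%:R -> r b = y%:R ->
  (x + y <= N)%N -> Q (upd r d (x + y)%:R) m -> wp (Arith Add d a b) k.+1 Q r m.
Proof. by move=> ra rb zN; apply: (@wp_add _ _ _ _ x y). Qed.

Lemma wp_sub k d a b (x y : int) (Q : post) r m : r a = x%:~R -> r b = y%:~R ->
  `|x - y| <= N%:Z -> Q (upd r d (x - y)%:~R) m -> wp (Arith Defs.Sub d a b) k.+1 Q r m.
Proof.
move=> ra rb zN; apply: wp_arith; last exact: rat_length_int zN.
by rewrite /= ra rb intrB.
Qed.

Lemma wp_mul k d a b (x y : int) (Q : post) r m : r a = x%:~R -> r b = y%:~R ->
  `|x * y| <= N%:Z -> Q (upd r d (x * y)%:~R) m -> wp (Arith Mul d a b) k.+1 Q r m.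
Proof.
move=> ra rb zN; apply: wp_arith; last exact: rat_length_int zN.
by rewrite /= ra rb intrM.
Qed.

Lemma wp_div k d a b (x y : int) (Q : post) r m : r a = x%:~R -> r b = y%:~R ->
  `|x| <= N%:Z -> `|y| <= N%:Z -> y != 0 ->
  Q (upd r d (x%:~R / y%:~R)) m -> wp (Arith Div d a b) k.+1 Q r m.
Proof.
move=> ra rb xN yN y0; apply: wp_arith; last exact: rat_length_div xN yN y0.
by rewrite /= ra rb intr_eq0 (negPf y0).
Qed.

(* Registers 0-8 hold n, |E|, 1, 0, the address T of c, 2n, the least ratio     *)
(* found, the address of its direction and a flag telling whether one was       *)
(* found; 9-13 are local to the scan over E.  flip_prog is called with the      *)
(* address of e in register 20, uses only registers from 20 on, flips x in      *)
(* place, advances register 20 past e and returns c d and w d for the           *)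
(* displacement d in registers 24 and 25.                                       *)
Definition flip_body : cmd :=
  Read 26 20 ;; Read 27 21 ;; Read 28 22 ;; Read 29 23 ;; Move 30 21 ;;
  Arith Mul 26 26 26 ;;
  Arith Add 20 20 2 ;; Arith Add 21 21 2 ;; Arith Add 22 22 2 ;; Arith Add 23 23 2 ;;
  IfLe 26 3 Skip
   (Arith Defs.Sub 31 2 27 ;; Write 30 31 ;; Arith Defs.Sub 31 31 27 ;;
    Arith Mul 28 28 31 ;; Arith Add 24 24 28 ;;
    Arith Mul 29 29 31 ;; Arith Add 25 25 29).

Definition flip_prog : cmd :=
  Const 21 0 ;; Move 22 4 ;; Move 23 0 ;; Const 24 0 ;; Const 25 0 ;;
  WhileLt 21 0 flip_body.

(** The integer memory after j rounds of the flip loop. *)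
Definition flipmem (mi : nat -> int) (e j a : nat) : int :=
  if (a < j)%N && (mi (e + a)%N != 0) then 1 - mi a else mi a.

(** A partial scalar product with the displacement, which is 1 - 2 x_i on the support of e and 0
    elsewhere. The offset [o] is T for c and n for w. *)
Definition flipsum (mi : nat -> int) (e o j : nat) : int :=
  \sum_(i < j) if mi (e + i)%N == 0 then 0 else mi (o + i)%N * (1 - mi i - mi i).

Variables (T K : nat).
Hypothesis TN : (T + n <= N)%N.
Hypothesis KN : (K * K + n * K + K + 2 <= N)%N.

Definition env (r : nat -> rat) : Prop :=
  [/\ r 0%N = n%:R, r 2%N = 1, r 3%N = 0 & r 4%N = T%:R].

Definition holds (m : nat -> rat) (mi : nat -> int) : Prop := forall a, m a = (mi a)%:~R.

(** K bounds what is stored, the larger N what is computed: squares of entries and sums of n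
    entries. *)
Definition memory_ok (mi : nat -> int) : Prop :=
  (forall a, `|mi a| <= K%:Z) /\ (forall a, (a < n)%N -> mi a = 0 \/ mi a = 1).

Lemma flipterm_bound mi e o j : memory_ok mi -> (j < n)%N ->
  `|if mi (e + j)%N == 0 then 0 else mi (o + j)%N * (1 - mi j - mi j)| <= K%:Z.
Proof.
move=> [mK m01] jn; case: eqP => // _; rewrite normrM.
by have [->|->] := m01 j jn; rewrite mulr1; apply: mK.
Qed.

Lemma flipsum_bound mi e o j : memory_ok mi -> (j <= n)%N ->
  `|flipsum mi e o j| <= (j * K)%N%:Z.
Proof.
move=> [mK m01]; elim: j => [|j IHj] jn; first by rewrite /flipsum big_ord0.
rewrite /flipsum big_ord_recr /= mulSnr PoszD.
apply: le_trans (ler_normD _ _) _; apply: lerD; first exact: (IHj (ltnW jn)).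
exact: flipterm_bound.
Qed.

(** Since n <= e and n <= T, the cells of e, w and c lie outside those being rewritten. *)
Lemma flip_wp mi e r m : env r -> holds m mi -> memory_ok mi ->
  (n <= e)%N -> (e + n <= N)%N -> (n <= T)%N -> r 20%N = e%:R ->
  wp flip_prog (n * 21 + 6) (fun r' m' =>
    [/\ forall a, (a < 20)%N -> r' a = r a,
        r' 20%N = (e + n)%:R, holds m' (flipmem mi e n),
        r' 24%N = (flipsum mi e T n)%:~R & r' 25%N = (flipsum mi e n n)%:~R]) r m.
Proof.
move=> [r0 r2 r3 r4] mE mok ne eN nT r20.
have [mK m01] := mok.
rewrite addnC /flip_prog.
apply: wp_cons; apply: wp_consti => //.
apply: wp_cons; apply: wp_move.
apply: wp_cons; apply: wp_move.
apply: wp_cons; apply: wp_consti => //.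
apply: wp_cons; apply: wp_consti => //.
pose I i (r' m' : nat -> rat) := exists2 j : nat, (j + i = n)%N &
  [/\ forall a, (a < 20)%N -> r' a = r a, holds m' (flipmem mi e j),
  r' 20%N = (e + j)%:R &
  [/\ r' 21%N = j%:R, r' 22%N = (T + j)%:R, r' 23%N = (n + j)%:R,
  r' 24%N = (flipsum mi e T j)%:~R & r' 25%N = (flipsum mi e n j)%:~R]].
(* The body takes 10 straight instructions, 2 for the conditional and 7 in its longer branch. *)
apply: (@wp_while _ _ _ 19 _ _ _ _ I _ n).
- move=> i r' m' [j ji [fr mE' r20' [r21' r22' r23' r24' r25']]].
  rewrite r21' fr// r0 ltr_nat => jn.
  apply: wp_cons; apply: wp_read; first exact: r20'.
  apply: wp_cons; apply: wp_read; first exact: r21'.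
  apply: wp_cons; apply: wp_read; first exact: r22'.
  apply: wp_cons; apply: wp_read; first exact: r23'.
  apply: wp_cons; apply: wp_move.
  rewrite /upd /=.
  have mj k : (n <= k)%N -> m' (k + j)%N = (mi (k + j)%N)%:~R.
    by move=> nk; rewrite mE' /flipmem ltnNge (leq_trans _ (leq_addr _ _)) ?(leq_trans (ltnW jn))//.
  have mj0 : m' j = (mi j)%:~R by rewrite mE' /flipmem ltnn.
  have r3' : r' 3%N = 0%:~R by rewrite fr.
  have r2' : r' 2%N = 1%:R by rewrite fr.
  rewrite !mj// mj0 r21'.
  have sq k : `|mi k * mi k| <= N%:Z.
    by rewrite normrM; apply: le_trans (ler_pM _ _ (mK k) (mK k)) _ => //; lia.
  apply: wp_cons; apply: (@wp_mul _ _ _ _ (mi (e + j)%N) (mi (e + j)%N)) => //=.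
  rewrite /upd /=.
  apply: wp_cons; apply: (@wp_addn _ _ _ _ (e + j) 1) => //=; first lia.
  apply: wp_cons; apply: (@wp_addn _ _ _ _ j 1) => //=; first lia.
  apply: wp_cons; apply: (@wp_addn _ _ _ _ (T + j) 1) => //=; first lia.
  apply: wp_cons; apply: (@wp_addn _ _ _ _ (n + j) 1) => //=; first lia.
  rewrite /upd /=.
  have step (rr mm : nat -> rat) :
      (forall a, (a < 20)%N -> rr a = r' a) ->
      rr 20%N = (e + j + 1)%:R -> rr 21%N = (j + 1)%:R -> rr 22%N = (T + j + 1)%:R ->
      rr 23%N = (n + j + 1)%:R ->
      holds mm (flipmem mi e j.+1) ->
      rr 24%N = (flipsum mi e T j.+1)%:~R -> rr 25%N = (flipsum mi e n j.+1)%:~R ->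
      exists2 j', (j' < i)%N & I j' rr mm.
    move=> fr2 h20 h21 h22 h23 hm h24 h25; exists i.-1; first lia.
    exists j.+1; first lia; split=> //; first by move=> a a20; rewrite fr2 ?fr.
      by rewrite h20 addn1 addnS.
    by split=> //; rewrite ?h21 ?h22 ?h23 ?addn1 ?addnS.
  apply: wp_if => /=; rewrite r3' ?ler_int ?ltr_int => ej.
    have ej0 : mi (e + j)%N = 0 by nia.
    apply: wp_skip; apply: step => //=.
    - by move=> a a20; do ![case: eqP => [?|_]; first lia].
    - move=> a; rewrite mE' /flipmem ltnS (leq_eqVlt a j).
      by case: (a =P j) => [->|_] //=; rewrite ltnn ej0.
    - by rewrite r24' /flipsum big_ord_recr /= ej0 addr0.
    - by rewrite r25' /flipsum big_ord_recr /= ej0 addr0.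
  have ej0 : mi (e + j)%N != 0 by apply: contraTneq ej => ->; rewrite mulr0 ltxx.
  have x01 := m01 j jn.
  have tb o : `|mi (o + j)%N * (1 - mi j - mi j)| <= K%:Z.
    by have := flipterm_bound e o mok jn; rewrite (negPf ej0).
  have sb o : `|flipsum mi e o j + mi (o + j)%N * (1 - mi j - mi j)| <= (n * K)%N%:Z.
    have := flipsum_bound e o mok jn.
    rewrite {1}/flipsum big_ord_recr /= (negPf ej0) => /le_trans; apply.
    by rewrite lez_nat leq_mul.
  apply: wp_cons; apply: (@wp_sub _ _ _ _ 1 (mi j)) => //=; first by case: x01 => ->; lia.
  apply: wp_cons; apply: (@wp_write _ _ _ _ _ _ j) => //=.
  rewrite /upd /=.
  apply: wp_cons; apply: (@wp_sub _ _ _ _ (1 - mi j) (mi j)) => //=; first by case: x01 => ->; lia.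
  apply: wp_cons; apply: (@wp_mul _ _ _ _ (mi (T + j)%N) (1 - mi j - mi j)) => //=.
    by apply: le_trans (tb _) _; lia.
  apply: wp_cons; apply: (@wp_add _ _ _ _ (flipsum mi e T j) (mi (T + j)%N * (1 - mi j - mi j))) => //=.
    by apply: le_trans (sb _) _; lia.
  apply: wp_cons; apply: (@wp_mul _ _ _ _ (mi (n + j)%N) (1 - mi j - mi j)) => //=.
    by apply: le_trans (tb _) _; lia.
  apply: (@wp_add _ _ _ _ (flipsum mi e n j) (mi (n + j)%N * (1 - mi j - mi j))) => //=.
    by apply: le_trans (sb _) _; lia.
  rewrite /upd /=; apply: step => //=.
  - by move=> a a20; do ![case: eqP => [?|_]; first lia].
  - move=> a; rewrite /flipmem ltnS (leq_eqVlt a j).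
    by case: (a =P j) => [->|_] /=; [rewrite ej0|exact: mE'].
  - by rewrite /flipsum big_ord_recr /= (negPf ej0).
  - by rewrite /flipsum big_ord_recr /= (negPf ej0).
- move=> i r' m' [j ji [fr mE' r20' [r21' r22' r23' r24' r25']]].
  rewrite r21' fr// r0 ler_nat => nj; have jn : j = n by lia.
  by rewrite jn in mE' r20' r24' r25'.
- by [].
- exists 0%N; first by rewrite add0n.
  rewrite /upd /= !addn0 r0 r4 /flipsum !big_ord0; split=> //.
  by move=> a a20; do ![case: eqP => [?|_]; first lia].
Qed.

Definition vec (mi : nat -> int) (o : nat) : 'rV[int]_n := \row_i mi (o + i)%N.

Lemma vec_flipmem mi e : (n <= e)%N -> vec (flipmem mi e n) 0 = flip (vec mi 0) (vec mi e).
Proof. by move=> ne; apply/rowP => i; rewrite !mxE /flipmem !add0n ltn_ord; case: eqP. Qed.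

Lemma flipsum_dot mi e o : flipsum mi e o n =
  dot (vec mi o) (flip (vec mi 0) (vec mi e) - vec mi 0).
Proof.
apply: eq_bigr => i _; rewrite !mxE add0n; case: eqP => _ //.
by rewrite subrr mulr0.
Qed.

(** The direction is not overwritten, so both passes flip the same coordinates. *)
Lemma flipmemK mi e : (n <= e)%N -> flipmem (flipmem mi e n) e n =1 mi.
Proof.
move=> ne a; rewrite /flipmem (ltnNge (e + a)) (leq_trans ne (leq_addr _ _)) /=.
by case: (_ && _) => //; rewrite subKr.
Qed.

Lemma memory_ok_flip mi e : (0 < K)%N -> memory_ok mi -> memory_ok (flipmem mi e n).
Proof.
move=> K0 [mK m01]; split=> a; rewrite /flipmem.
  by case: ifP => [/andP[/m01[->|->] _]|_] //; lia.
by case: ifP => [/andP[/m01[->|->] _] _|_ /m01//]; [right|left].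
Qed.

(* Flipping twice restores x. *)
Definition probe_prog : cmd :=
  Move 20 9 ;; flip_prog ;; Query 10 3 ;; Move 11 24 ;; Move 12 25 ;;
  Move 20 9 ;; flip_prog.

Lemma probe_wp mi e r m : (0 < K)%N -> env r -> holds m mi -> memory_ok mi ->
  (n <= e)%N -> (e + n <= N)%N -> (n <= T)%N -> r 9%N = e%:R ->
  let z := flip (vec mi 0) (vec mi e) in
  wp probe_prog (n * 42 + 17) (fun r' m' =>
    [/\ forall a, (a < 10)%N -> r' a = r a, holds m' mi,
        r' 10%N = (z \in S)%:R, r' 11%N = (dot (vec mi T) (z - vec mi 0))%:~R &
        r' 12%N = (dot (vec mi n) (z - vec mi 0))%:~R /\ r' 20%N = (e + n)%:R]) r m.
Proof.
move=> K0 re mE mok ne eN nT r9 z; have [r0 r2 r3 r4] := re.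
rewrite (_ : n * 42 + 17 = (n * 21 + 6 + (n * 21 + 6).+4).+1)%N; last lia.
apply: wp_cons; apply: wp_move.
apply: (wp_seq (leqnn _)); apply: wp_post; last first.
  by apply: (@flip_wp mi e).
move=> r1 m1 [fr1 r1e mE1 r124 r125].
have x'E : window n m1 0 = embed rat z.
  by rewrite /z -vec_flipmem//; apply/rowP => i; rewrite !mxE mE1.
apply: wp_cons; apply: (wp_query _ _ x'E) => //.
- by rewrite fr1.
- by apply: (@rat_length_int _ (Posz (z \in S))) => //; case: (z \in S); lia.
apply: wp_cons; apply: wp_move.
apply: wp_cons; apply: wp_move.
apply: wp_cons; apply: wp_move.
rewrite /upd /=; apply: wp_post; last first.
  apply: (@flip_wp (flipmem mi e n) e) => //=.
  - by split=> /=; rewrite fr1.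
  - exact: memory_ok_flip.
  - by rewrite fr1.
move=> r2' m2 [fr2 r2e mE2 _ _]; split=> //.
- move=> a a10; rewrite fr2 ?(ltn_trans a10)//=; do ![case: eqP => [?|_]; first lia].
  by rewrite fr1 ?(ltn_trans a10)//= /upd; case: eqP => [?|_]; first lia.
- by move=> a; rewrite mE2 flipmemK.
- by rewrite fr2.
- by rewrite fr2//= r124 flipsum_dot.
- by rewrite fr2//= r125 flipsum_dot.
Qed.

(** * Scanning E for the improving flip of least ratio *)

Definition scan_body : cmd :=
  probe_prog ;; Move 13 9 ;; Move 9 20 ;;
  IfLe 10 3 Skip
   (IfLe 12 3 Skip
     (Arith Defs.Sub 11 3 11 ;; Arith Div 11 11 12 ;;
      let update := Move 6 11 ;; Move 7 13 ;; Const 8 1 in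
      IfLe 8 3 update (IfLe 6 11 Skip update))).

Definition scan_prog : cmd := Const 8 0 ;; Move 9 5 ;; WhileLt 9 4 scan_body.

Section Scan.
Variables (mi : nat -> int) (M : nat).
Hypothesis K0 : (0 < K)%N.
Hypothesis mok : memory_ok mi.
Hypothesis TE : T = (2 * n + M * n)%N.

Let e_ k := vec mi (2 * n + k * n)%N.
Let gain k := dot (vec mi n) (flip (vec mi 0) (e_ k) - vec mi 0).
Let rho k := ratio (vec mi T) (vec mi n) (flip (vec mi 0) (e_ k) - vec mi 0).
(** Flips that lie in S without being adjacent to x also count. They do no harm, as the strict
    minimum over all improving points of S is a neighbour obtained by such a flip. *)
Let cand k : Prop := S (flip (vec mi 0) (e_ k)) /\ 0 < gain k.

Definition scanned (k : nat) (r : nat -> rat) : Prop :=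
  (r 8%N = 0 /\ forall i, (i < k)%N -> ~ cand i) \/
  (r 8%N = 1 /\ exists i, [/\ (i < k)%N, r 7%N = (2 * n + i * n)%:R, cand i, r 6%N = rho i &
     forall i', (i' < k)%N -> cand i' -> rho i <= rho i']).

Lemma scan_wp r m : env r -> holds m mi -> r 5%N = (2 * n)%:R ->
  wp scan_prog (M * (n * 42 + 34) + 3) (fun r' m' =>
    [/\ forall a, (a < 6)%N -> r' a = r a, holds m' mi & scanned M r']) r m.
Proof.
move=> re mE r5; have [r0 r2 r3 r4] := re.
rewrite addnC /scan_prog.
apply: wp_cons; apply: wp_consti => //.
apply: wp_cons; apply: wp_move.
pose I i (r' m' : nat -> rat) := exists2 k : nat, (k + i = M)%N &
  [/\ forall a, (a < 6)%N -> r' a = r a, holds m' mi, r' 9%N = (2 * n + k * n)%:R & scanned k r'].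
apply: (@wp_while _ _ _ (n * 42 + 32) _ _ _ _ I _ M).
- move=> i r1 m1 [k ki [fr1 mE1 r19 sc]].
  rewrite r19 fr1// r4 ltr_nat TE ltn_add2l ltn_mul2r => /andP[n0 kM].
  apply: (@wp_seq _ _ _ (n * 42 + 17) 15); first lia.
  apply: wp_post; last first.
    apply: (@probe_wp mi (2 * n + k * n)) => //; [|lia| |lia].
      by split; rewrite fr1.
    have : (k.+1 * n <= M * n)%N by rewrite leq_mul2r kM orbT.
    by lia.
  move=> r2' m2 [fr2 mE2 r210 r211 [r212 r220]].
  apply: wp_cons; apply: wp_move.
  apply: wp_cons; apply: wp_move.
  rewrite /upd /= (fr2 9%N)// r19 r220.
  set rr := (fun b : nat => if b == 9%N then _ else _).
  have step (r' : nat -> rat) : (forall a, (a < 6)%N || (a == 9)%N -> r' a = rr a) ->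
      scanned k.+1 r' -> exists2 j', (j' < i)%N & I j' r' m2.
    move=> fr3 hs; exists i.-1; first lia.
    exists k.+1; first lia; split=> //.
      move=> a a6; rewrite fr3 ?a6// /rr; do ![case: eqP => [?|_]; first lia].
      by rewrite fr2 ?fr1//; apply: ltn_trans a6 _.
    by rewrite fr3// /rr /= (mulSnr k) addnA.
  have rr_lt a : (a < 9)%N -> rr a = r1 a.
    by move=> a9; rewrite /rr; do ![case: eqP => [?|_]; first lia]; rewrite fr2//; lia.
  have rr3 : rr 3%N = 0%:~R by rewrite rr_lt// fr1.
  have noncand : ~ cand k -> exists2 j', (j' < i)%N & I j' rr m2.
    move=> nc; apply: step => //; case: sc => [[f0 h]|[f1 [i0 [i0k h7 ci h6 hmin]]]].
      left; rewrite rr_lt//; split=> // i'; rewrite ltnS leq_eqVlt.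
      by move=> /predU1P[->//|]; apply: h.
    right; rewrite !rr_lt//; split=> //; exists i0; rewrite (ltn_trans i0k)//; split=> // i'.
    by rewrite ltnS leq_eqVlt => /predU1P[->//|]; apply: hmin.
  have rr10 : rr 10%N = (flip (vec mi 0) (e_ k) \in S)%:R by [].
  have rr11 : rr 11%N = (dot (vec mi T) (flip (vec mi 0) (e_ k) - vec mi 0))%:~R by [].
  have rr12 : rr 12%N = (gain k)%:~R by [].
  apply: wp_if; rewrite rr3 rr10 => zS.
    apply: wp_skip; apply: noncand => -[/mem_set zS' _].
    by move: zS; rewrite zS' ler10.
  apply: wp_if; rewrite rr3 rr12 ?ler_int ?ltr_int => gk.
    by apply: wp_skip; apply: noncand => -[_]; rewrite ltNge gk.
  have ck : cand k.
    split=> //; apply: set_mem; apply: contraLR zS => /negPf ->.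
    by rewrite ltxx.
  have cb : `|dot (vec mi T) (flip (vec mi 0) (e_ k) - vec mi 0)| <= N%:Z.
    by rewrite -flipsum_dot; apply: le_trans (flipsum_bound _ _ mok (leqnn n)) _; lia.
  have wb : `|gain k| <= N%:Z.
    by rewrite /gain -flipsum_dot; apply: le_trans (flipsum_bound _ _ mok (leqnn n)) _; lia.
  apply: wp_cons; apply: (@wp_sub _ _ _ _ 0 _ _ _ _ rr3 rr11).
    by rewrite sub0r normrN.
  apply: wp_cons; apply: (@wp_div _ _ _ _ _ (gain k)) => //; [by rewrite sub0r normrN|by rewrite gt_eqF|].
  set rd := upd _ 11 _; have rd11 : rd 11%N = rho k by rewrite /rd /upd /= sub0r mulrNz.
  have rd_ne a : a != 11%N -> rd a = rr a by rewrite /rd /upd => /negPf ->.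
  have update_wp : (forall i', (i' < k)%N -> cand i' -> rho k <= rho i') ->
      wp (Move 6 11 ;; Move 7 13 ;; Const 8 1) 3
       (fun r' m' => exists2 j', (j' < i)%N & I j' r' m') rd m2.
    move=> hmin; apply: wp_cons; apply: wp_move; apply: wp_cons; apply: wp_move.
    apply: wp_consti; first lia.
    apply: step => [a a6|].
      by rewrite /upd; do ![case: eqP => [?|_]; first lia]; rewrite rd_ne//; lia.
    right; rewrite /upd /= rd11 rd_ne//; split=> //; exists k; split=> // i'.
    by rewrite ltnS leq_eqVlt => /predU1P[->//|]; apply: hmin.
  apply: wp_if; rewrite !rd_ne// rr3 rr_lt//; case: sc => [[f0 h]|[f1 [i0 [i0k h7 ci h6 hmin]]]].
  - by move=> _; apply: (wp_leq _ (update_wp _)) => // i' /h.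
  - by rewrite f1 ler10.
  - by rewrite f0 ltxx.
  move=> _; apply: wp_if; rewrite rd11 rd_ne// rr_lt// h6 => cmp.
    apply: wp_skip; apply: step => [a a6|]; first by rewrite rd_ne//; lia.
    right; rewrite !rd_ne// !rr_lt//; split=> //; exists i0; rewrite (ltn_trans i0k)//; split=> // i'.
    by rewrite ltnS leq_eqVlt => /predU1P[->//|]; apply: hmin.
  by apply: update_wp => i' i'k ci'; apply: le_trans (ltW cmp) (hmin _ _ _).
- move=> i r1 m1 [k ki [fr1 mE1 r19 sc]].
  rewrite r19 fr1// r4 ler_nat TE leq_add2l leq_mul2r => /orP[/eqP n0|Mk]; last first.
    by have <- : k = M by lia.
  split=> //.
  (* For n = 0 the loop ends before reading E, but then every gain is an empty sum and nothing is a
     candidate. *)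
  have nc i' : ~ cand i'.
    by move=> [_]; rewrite /gain /dot big1// => j; have := ltn_ord j; rewrite [X in (_ < X)%N]n0.
  by case: sc => [[f0 _]|[_ [i' [_ _ /nc]]]] //; left.
- by rewrite mulnDr; lia.
- exists 0%N; first by rewrite add0n.
  split=> //; [|by rewrite /= /upd /= r5 addn0|by left].
  by move=> a a6; rewrite /upd; do ![case: eqP => [?|_]; first lia].
Qed.
End Scan.

End Wp.

(** * Computing the initial objective, and the pivot loop *)

Section Main.
Variables (n : nat) (S : set 'rV[int]_n) (N T K M : nat).
Hypothesis N0 : (0 < N)%N.
Hypothesis TN : (T + n <= N)%N.
Hypothesis TE : T = (2 * n + M * n)%N.
Local Notation wp := (wp S (word N)).

(** Register 15 first runs over the addresses n to 2n - 1 of w while 14 collects the squares; 14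
    then becomes B, and 16 runs through its powers. *)
Definition weights_prog : cmd :=
  Const 2 1 ;; Const 3 0 ;;
  Arith Mul 4 0 1 ;; Arith Add 5 0 0 ;; Arith Add 4 4 5 ;;
  Const 14 1 ;; Move 15 0 ;;
  WhileLt 15 5
    (Read 16 15 ;; Arith Mul 16 16 16 ;; Arith Add 14 14 16 ;; Arith Add 15 15 2) ;;
  Arith Mul 14 14 14 ;; Arith Add 14 14 14 ;;
  Const 15 0 ;; Const 16 1 ;; Move 17 4 ;;
  WhileLt 15 0
    (Read 18 15 ;; Arith Add 18 18 18 ;; Arith Defs.Sub 18 18 2 ;;
     Arith Mul 18 18 16 ;; Write 17 18 ;;
     Arith Mul 16 16 14 ;; Arith Add 15 15 2 ;; Arith Add 17 17 2).

Definition weightmem (mi : nat -> int) (B : int) (j a : nat) : int :=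
  if (T <= a < T + j)%N then (mi (a - T)%N *+ 2 - 1) * B ^+ (a - T) else mi a.

(** The last round still multiplies by B, so B^n itself must fit. *)
Lemma weights_wp mi r m : r 0%N = n%:R -> r 1%N = M%:R -> holds m mi ->
  (forall a, (a < n)%N -> mi a = 0 \/ mi a = 1) -> (forall a, `|mi a| <= N%:Z) ->
  let B := base (vec n mi n) in B <= N%:Z -> B ^+ n <= N%:Z -> (1 < N)%N ->
  wp weights_prog (16 * n + 14) (fun r' m' =>
    [/\ env n T r', r' 5%N = (2 * n)%:R & holds m' (weightmem mi B n)]) r m.
Proof.
move=> r0 r1 mE m01 miN B BN BnN N1.
pose s j : int := 1 + \sum_(i < j) mi (n + i)%N ^+ 2.
have s1 j : 1 <= s j by rewrite lerDl; apply: sumr_ge0 => i _; apply: sqr_ge0.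
have sn : B = s n ^+ 2 *+ 2.
  by rewrite /B /base /s; congr ((1 + _) ^+ 2 *+ 2); apply: eq_bigr => i _; rewrite mxE.
have sle i j : (i <= j)%N -> s i <= s j.
  elim: j => [|j IHj]; first by rewrite leqn0 => /eqP ->.
  rewrite leq_eqVlt => /predU1P[->//|/IHj/le_trans]; apply.
  by rewrite /s big_ord_recr /= addrA lerDl sqr_ge0.
have sB : s n <= s n ^+ 2 /\ s n ^+ 2 <= B.
  by rewrite sn mulr2n lerDl sqr_ge0 ler_eXnr.
have B2 : 2 <= B by have := s1 n; rewrite sn mulr2n; case: sB; lia.
have sS j : s j.+1 = s j + mi (n + j)%N * mi (n + j)%N.
  by rewrite /s big_ord_recr /= addrA expr2.
have sN j : (j <= n)%N -> `|s j| <= N%:Z.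
  by move=> jn; have := sle _ _ jn; have := s1 j; lia.
have sqN j : (j < n)%N -> `|mi (n + j)%N * mi (n + j)%N| <= N%:Z.
  move=> jn; have := sN _ jn; rewrite sS; move: (s1 j) (sqr_ge0 (mi (n + j)%N)).
  rewrite expr2; move: (s j) (mi _ * mi _) => u v; lia.
have BjN j : (j <= n)%N -> `|B ^+ j| <= N%:Z.
  move=> jn; rewrite ger0_norm; last by rewrite exprn_ge0//; lia.
  by apply: le_trans BnN; rewrite ler_weXn2l//; lia.
have MnT : (M * n <= T)%N by rewrite TE leq_addl.
rewrite (_ : 16 * n + 14 = (n * 6 + 1 + (n * 10 + 1).+4.+1).+4.+3)%N; last lia.
apply: wp_cons; apply: wp_consti => //.

apply: wp_cons; apply: wp_consti => //.
apply: wp_cons; apply: (@wp_mul _ _ _ _ _ _ _ _ n M) => //; first lia.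
rewrite /upd /=.
apply: wp_cons; apply: (@wp_addn _ _ _ _ _ _ _ _ n n) => //; first lia.
apply: wp_cons; apply: (@wp_addn _ _ _ _ _ _ _ _ (n * M) (n + n)) => //; first lia.
apply: wp_cons; apply: wp_consti => //.
apply: wp_cons; apply: wp_move.
rewrite /upd /= r0 (_ : n * M + (n + n) = T)%N; last lia.
set rr := fun b : nat => _.
apply: (wp_seq (leqnn _)).
pose I i (r' m' : nat -> rat) := exists2 j : nat, (j + i = n)%N &
  [/\ forall a, (a < 14)%N -> r' a = rr a, holds m' mi, r' 14%N = (s j)%:~R & r' 15%N = (n + j)%:R].
apply: (@wp_while _ _ _ 4 _ _ _ _ I _ n).
- move=> i r' m' [j ji [fr mE' r14 r15]].
  rewrite r15 fr// ltr_nat ltn_add2l => jn.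
  apply: wp_cons; apply: wp_read; first exact: r15.
  apply: wp_cons; apply: (@wp_mul _ _ _ _ _ _ _ _ (mi (n + j)%N) (mi (n + j)%N)) => //=; [exact: mE'|exact: mE'|exact: sqN|].
  rewrite /upd /=.
  apply: wp_cons; apply: (@wp_add _ _ _ _ _ _ _ _ (s j) (mi (n + j)%N * mi (n + j)%N)) => //=.
    by rewrite -sS; exact: sN.
  apply: (@wp_addn _ _ _ _ _ _ _ _ (n + j) 1) => //=; [by rewrite /upd /= fr|lia|].
  rewrite /upd /=; exists i.-1; first lia.
  exists j.+1; first lia; split=> //.
  + by move=> a a14; do ![case: eqP => [?|_]; first lia]; rewrite fr.
  + by rewrite /= sS.
  + by rewrite /= addn1 addnS.
- move=> i r' m' [j ji [fr mE' r14 r15]].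
  rewrite r15 fr// ler_nat leq_add2l => nj.
  have {ji nj i} jn : j = n by lia.
  rewrite {j}jn in r14 r15.
  have B0 : B = s n * s n + s n * s n by rewrite sn mulr2n expr2.
  have r2E : r' 2%N = 1%:R by rewrite fr.
  have sqB : `|s n * s n| <= N%:Z by move: sB (s1 n); rewrite expr2; move: (s n * s n); lia.
  apply: wp_cons; apply: (@wp_mul _ _ _ _ _ _ _ _ (s n) (s n)) => //.
  rewrite /upd /=.
  apply: wp_cons; apply: (@wp_add _ _ _ _ _ _ _ _ (s n * s n) (s n * s n)) => //; first by rewrite -B0; lia.
  apply: wp_cons; apply: wp_consti => //.
  apply: wp_cons; apply: wp_consti => //.
  apply: wp_cons; apply: wp_move.
  rewrite -B0 /upd /= fr//.
  set r2 := fun b : nat => _.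
  pose J i (r3 m3 : nat -> rat) := exists2 j : nat, (j + i = n)%N &
    [/\ forall a, (a < 15)%N -> r3 a = r2 a, holds m3 (weightmem mi B j),
      r3 15%N = j%:R, r3 16%N = (B ^+ j)%:~R & r3 17%N = (T + j)%:R].
  apply: (@wp_while _ _ _ 8 _ _ _ _ J _ n).
  + move=> i r3 m3 [j ji [fr3 mE3 r315 r316 r317]].
    have r30 : r3 0%N = n%:R by rewrite fr3// /r2 /= fr.
    have r32 : r3 2%N = 1 by rewrite fr3.
    rewrite r315 r30 ltr_nat => jn.
    have m3j : m3 j = (mi j)%:~R by rewrite mE3 /weightmem leqNgt (leq_trans jn)//; lia.
    apply: wp_cons; apply: wp_read; first exact: r315.
    rewrite /upd /= m3j.
    have x01 := m01 j jn.
    apply: wp_cons; apply: (@wp_add _ _ _ _ _ _ _ _ (mi j) (mi j)) => //=; first by case: x01 => ->; lia.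
    rewrite /upd /=.
    apply: wp_cons; apply: (@wp_sub _ _ _ _ _ _ _ _ (mi j + mi j) 1) => //=; first by case: x01 => ->; lia.
    rewrite /upd /=.
    apply: wp_cons; apply: (@wp_mul _ _ _ _ _ _ _ _ (mi j + mi j - 1) (B ^+ j)) => //=.
      by rewrite normrM; case: x01 => ->; rewrite ?subrr ?sub0r ?normrN ?addrK normr1 mul1r BjN// ltnW.
    rewrite /upd /=.
    apply: wp_cons; apply: wp_write => /=; first exact: r317.
    apply: wp_cons; apply: (@wp_mul _ _ _ _ _ _ _ _ (B ^+ j) B) => //=.
      by rewrite /upd /= fr3.
      by rewrite -exprSr BjN.
    rewrite /upd /=.
    apply: wp_cons; apply: (@wp_addn _ _ _ _ _ _ _ _ j 1) => //=; first lia.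
    rewrite /upd /=.
    apply: (@wp_addn _ _ _ _ _ _ _ _ (T + j) 1) => //=; first lia.
    rewrite /upd /=; exists i.-1; first lia.
    exists j.+1; first lia; split=> //=.
    * by move=> a a15; do ![case: eqP => [?|_]; first lia]; rewrite fr3.
    * move=> a; rewrite mE3 /weightmem; case: (a =P (T + j)%N) => [->|aTj].
        by rewrite leq_addr addnS leqnn addKn /= mulr2n.
      by congr (if _ then _ else _)%:~R; lia.
    * by rewrite addn1.
    * by rewrite exprSr.
    * by rewrite addn1 addnS.
  + move=> i r3 m3 [j ji [fr3 mE3 r315 r316 r317]].
    have r30 : r3 0%N = n%:R by rewrite fr3// /r2 /= fr.
    rewrite r315 r30 ler_nat => nj.
    have jn : j = n by lia.
    rewrite jn in mE3; split=> //.
      by split; rewrite fr3// /r2 /= fr.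
    by rewrite fr3// /r2 /= fr// /rr /= mul2n addnn.
  + lia.
  + exists 0%N; first by rewrite add0n.
    split=> //; last by rewrite /r2 /= addn0.
    by move=> a; rewrite mE' /weightmem addn0 ltnNge andbN.
- lia.
- exists 0%N; first by rewrite add0n.
  by split=> //; rewrite /rr /= ?addn0 ?r0// /s big_ord0 addr0.
Qed.

Definition pivot_loop : cmd :=
  Const 8 1 ;;
  WhileLt 3 8 (scan_prog ;; IfLe 8 3 Skip (Move 20 7 ;; flip_prog)).

(** There are at most M moves and one final scan that finds nothing: while the flag is up, the loop
    index is k + 1 in a [pivot_state] with k moves left. *)
Lemma pivot_loop_wp (R : realType) E x0 mi r m :
  (K * K + n * K + K + 2 <= N)%N -> (0 < K)%N -> size E = M ->
  S `<=` zero_one n -> zero_one n x0 ->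
  covers_edge_directions (conv_hull (embed R @` S)) E ->
  let w := vec n mi n in let c := weights x0 (base w) in
  (forall k, (k < M)%N -> vec n mi (2 * n + k * n) = nth 0 E k) ->
  vec n mi T = c -> pivot_state S c w E M (vec n mi 0) ->
  env n T r -> holds m mi -> memory_ok n K mi -> r 5%N = (2 * n)%:R ->
  wp pivot_loop (M.+1 * (M * (n * 42 + 34) + n * 21 + 14) + 2) (fun r' m' =>
    exists2 mi', holds m' mi' & optimal S w (vec n mi' 0)) r m.
Proof.
move=> KN K0 sE S01 x01 covE w c eE cE ps re mE mok r5; have [r0 r2 r3 r4] := re.
rewrite addn2 /pivot_loop.
have gen x y z : S x -> S y -> S z -> 0 < dot w (y - x) -> 0 < dot w (z - x) ->
    dot c (y - x) * dot w (z - x) = dot c (z - x) * dot w (y - x) -> y = z.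
  by move=> Sx Sy Sz; apply: (weights_base_generic x01); exact: S01.
apply: wp_cons; apply: wp_consti => //.
pose I j (r' m' : nat -> rat) := exists mi',
  [/\ holds m' mi', memory_ok n K mi', forall a, (n <= a)%N -> mi' a = mi a,
      forall a, (a < 6)%N -> r' a = r a &
      (r' 8%N = 1 /\ exists2 k, j = k.+1 & pivot_state S c w E k (vec n mi' 0)) \/
      (r' 8%N = 0 /\ optimal S w (vec n mi' 0))].
apply: (@wp_while _ _ _ (M * (n * 42 + 34) + n * 21 + 12) _ _ _ _ I _ M.+1).
- move=> j r1 m1 [mi1 [mE1 mok1 mi1E fr1 [[r18 [k jk ps1]]|[-> _]]]]; last first.
    by rewrite fr1// r3 ltxx.
  move=> _; pose x := vec n mi1 0.
  have vE o : (n <= o)%N -> vec n mi1 o = vec n mi o.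
    by move=> no; apply/rowP => i; rewrite !mxE mi1E// (leq_trans no) ?leq_addr.
  have e1E i : (i < M)%N -> vec n mi1 (2 * n + i * n) = nth 0 E i.
    by move=> iM; rewrite vE ?eE//; lia.
  have c1E : vec n mi1 T = c by rewrite vE// TE; lia.
  have w1E : vec n mi1 n = w by rewrite vE.
  have re1 : env n T r1 by split; rewrite fr1.
  rewrite (_ : _ + 12 = M * (n * 42 + 34) + 3 + (n * 21 + 6).+3)%N; last lia.
  apply: (wp_seq (leqnn _)); apply: wp_post; last first.
    by apply: (@scan_wp _ _ _ N0 _ K TN KN mi1 M) => //; rewrite fr1.
  move=> r2' m2 [fr2 mE2]; rewrite /scanned c1E w1E => sc.
  have r23 : r2' 3%N = 0 by rewrite fr2// fr1.
  have Sx : S x by have [? [? []]] := ps1.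
  apply: wp_if; rewrite r23; case: sc => [[r28 nc]|[r28 [i [iM r27 [Sz gi] r26 rmin]]]]; rewrite r28.
  - move=> _; apply: wp_skip; exists 0%N; first by rewrite jk.
    exists mi1; split=> //; first by move=> a a6; rewrite fr2 ?fr1.
    right; split=> //.
    split=> // z Sz; rewrite leNgt -subr_gt0 -dotBr; apply/negP => wz.
    (* An improving point would yield an improving flip along E, contradicting the empty scan. *)
    have [y [e [/(nthP 0)[i iE ei] yE Sy wy _]]] := pivot_step S01 covE gen ps1 Sz wz.
    by apply: (nc i); rewrite -?sE// e1E -?sE// ei -yE.
  - by rewrite ler10.
  - by rewrite ltxx.
  move=> _; have iE := e1E i iM.
  have [y [e [/(nthP 0)[i' i'E ei'] yE Sy wy [ymin [k' k'k ps']]]]] := pivot_step S01 covE gen ps1 Sz gi.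
  have i'M : (i' < M)%N by rewrite -sE.
  (* The scan has compared its result with y, which is itself a flip and the strict minimum over the
     improving points of S. *)
  have zy : flip x (nth 0 E i) = y.
    apply: contrapT => zy; have := rmin i' i'M; rewrite e1E// iE ei' -yE.
    by move=> /(_ (conj Sy wy)); rewrite leNgt ymin// -iE.
  apply: wp_cons; apply: wp_move.
  apply: wp_post; last first.
    apply: (@flip_wp _ _ _ N0 T K TN KN mi1 (2 * n + i * n)) => //.
    + by split; rewrite /upd /= fr2// fr1.
    + by lia.
    + have : (i.+1 * n <= M * n)%N by rewrite leq_mul2r iM orbT.
      by lia.
    + by lia.
  move=> r3' m3 [fr3 _ mE3 _ _]; exists k'.+1; first by rewrite jk ltnS.
  exists (flipmem mi1 (2 * n + i * n) n); split=> //.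
  + exact: memory_ok_flip.
  + by move=> a na; rewrite /flipmem ltnNge na /= mi1E.
  + move=> a a6; rewrite fr3 ?(ltn_trans a6)// /upd; case: eqP => [?|_]; first lia.
    by rewrite fr2 ?fr1.
  + left; split; first by rewrite fr3// /upd /= r28.
    by exists k' => //; rewrite vec_flipmem; [rewrite iE zy|lia].
- move=> j r1 m1 [mi1 [mE1 mok1 mi1E fr1 [[r18 _]|[_ opt]]]]; last by exists mi1.
  by rewrite r18 fr1// r3 ler10.
- by rewrite -addnS mulSnr; lia.
- exists mi; split=> //.
    by move=> a a6; rewrite /upd; case: eqP => [?|_]; first lia.
  by left; split=> //; exists M.
Qed.

End Main.

(** * Layout of the input and bounds in terms of its length *)

Definition input n (x w : 'rV[int]_n) (E : seq 'rV[int]_n) : seq int :=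
  entries x ++ entries w ++ flatten [seq entries e | e <- E].

Lemma size_entries n (z : 'rV[int]_n) : size (entries z) = n.
Proof. by rewrite size_map size_enum_ord. Qed.

Lemma nth_entries n (z : 'rV[int]_n) (i : 'I_n) : nth 0 (entries z) i = z 0 i.
Proof. by rewrite (nth_map i) ?size_enum_ord// nth_ord_enum. Qed.

Lemma nth_flatten_entries n (E : seq 'rV[int]_n) k (i : 'I_n) : (k < size E)%N ->
  nth 0 (flatten [seq entries e | e <- E]) (k * n + i) = (nth 0 E k) 0 i.
Proof.
elim: E k => // e E IHE [|k] /= kE; rewrite nth_cat size_entries.
  by rewrite mul0n add0n ltn_ord nth_entries.
by rewrite mulSn -addnA ltnNge leq_addr /= addKn IHE.
Qed.

Section Input.
Variables (n : nat) (x w : 'rV[int]_n) (E : seq 'rV[int]_n).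
Let mi a := nth 0 (input x w E) a.

Lemma vec_input_x : vec n mi 0 = x.
Proof.
by apply/rowP => i; rewrite mxE add0n /mi /input nth_cat size_entries ltn_ord nth_entries.
Qed.

Lemma vec_input_w : vec n mi n = w.
Proof.
apply/rowP => i; rewrite mxE /mi /input nth_cat size_entries ltnNge leq_addr /= addKn.
by rewrite nth_cat size_entries ltn_ord nth_entries.
Qed.

Lemma vec_input_E k : (k < size E)%N -> vec n mi (2 * n + k * n) = nth 0 E k.
Proof.
move=> kE; apply/rowP => i; rewrite mxE /mi /input mul2n -addnn -!addnA.
rewrite nth_cat size_entries ltnNge leq_addr /= addKn.
by rewrite nth_cat size_entries ltnNge leq_addr /= addKn nth_flatten_entries.
Qed.

Lemma sum_entries_length (z : 'rV[int]_n) :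
  (\sum_(a <- entries z) int_length a)%N = vec_length z.
Proof. by rewrite big_map big_enum. Qed.

Lemma sum_input_length :
  (\sum_(a <- input x w E) int_length a)%N = right_length x w E.
Proof.
rewrite !big_cat /= !sum_entries_length big_flatten big_map /= addnA.
by congr (_ + _)%N; apply: eq_bigr => e _; exact: sum_entries_length.
Qed.

Lemma input_bound a : `|mi a| <= (2 ^ right_length x w E)%N%:Z.
Proof.
have [ai|ia] := ltnP a (size (input x w E)); last by rewrite /mi nth_default.
have : (int_length (mi a) <= right_length x w E)%N.
  by rewrite -sum_input_length (big_rem (mi a)) ?mem_nth//= leq_addr.
rewrite /int_length => le; have := up_logP (`|mi a| + 1) (isT : 1 < 2)%N.
have : (2 ^ up_log 2 (`|mi a| + 1) <= 2 ^ right_length x w E)%N by rewrite leq_exp2l//; lia.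
lia.
Qed.

Lemma vec_length_ge (z : 'rV[int]_n) : (n <= vec_length z)%N.
Proof.
rewrite -[n in (n <= _)%N]card_ord -sum1_card; apply: leq_sum => i _.
by rewrite /int_length leq_addr.
Qed.

(** Every integer has length at least 1. *)
Lemma right_length_ge : (2 * n + size E * n <= right_length x w E)%N.
Proof.
rewrite mul2n -addnn; apply: leq_add; first by rewrite leq_add// vec_length_ge.
rewrite /set_length; elim: (E) => // e E' IHE.
by rewrite big_cons /= mulSn leq_add// vec_length_ge.
Qed.

End Input.

(** The extra 1 is for n = 0, where vectors have length 0 but E may still hold the single empty
    vector. *)
Lemma size_le_right_length n (x w : 'rV[int]_n) E :
  uniq E -> (size E <= (right_length x w E).+1)%N.
Proof.
case: n x w E => [|n] x w E uE; last first.
  apply/leqW/(leq_trans _ (right_length_ge x w E))/(leq_trans _ (leq_addl _ _)).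
  exact: leq_pmulr.
suff : (size E <= 1)%N by lia.
by case: E uE => [|a [|b E]] //=; rewrite inE (thinmx0 a) (thinmx0 b) eqxx.
Qed.

(** One bound on machine steps serves twice: evaluated at the left length for operations, and at r +
    2 for time. *)
Definition step_bound (X : {poly nat}) : {poly nat} :=
  16%N%:P * X + 16%N%:P + X * (X * (42%N%:P * X + 34%N%:P) + 21%N%:P * X + 14%N%:P).

Lemma step_boundE X v : (step_bound X).[v] =
  (16 * X.[v] + 16 + X.[v] * (X.[v] * (42 * X.[v] + 34) + 21 * X.[v] + 14))%N.
Proof. by rewrite /step_bound !(hornerD, hornerM, hornerC). Qed.

Lemma steps_le n M v : (n <= v)%N -> (M < v)%N ->
  (16 * n + 14 + (M.+1 * (M * (n * 42 + 34) + n * 21 + 14) + 2) <=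
   16 * v + 16 + v * (v * (42 * v + 34) + 21 * v + 14))%N.
Proof.
move=> nv Mv; have : (M.+1 * (M * (n * 42 + 34) + n * 21 + 14) <=
    v * (v * (42 * v + 34) + 21 * v + 14))%N.
  rewrite leq_mul// leq_add2r; apply: leq_add; last lia.
  by rewrite leq_mul ?(ltnW Mv)//; lia.
by move: (M.+1 * _)%N (v * _)%N => a b; lia.
Qed.

(** The sum 1 + n 4^r is at most 8^r because n < 2^r; squaring and doubling gives the exponent 6r +
    1. *)
Lemma base_bound n (w : 'rV[int]_n) r : (n <= r)%N ->
  (forall i, `|w 0 i| <= (2 ^ r)%N%:Z) -> base w <= (2 ^ (6 * r + 1))%N%:Z.
Proof.
move=> nr wr; have n2 : (n < 2 ^ r)%N by apply: leq_ltn_trans nr _; apply: ltn_expl.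
have s2 : 1 + \sum_(i < n) w 0 i ^+ 2 <= (2 ^ (3 * r))%N%:Z.
  apply: (@le_trans _ _ (1 + (n * (2 ^ r * 2 ^ r))%N%:Z)).
    rewrite lerD2l; apply: (@le_trans _ _ (\sum_(i < n) ((2 ^ r * 2 ^ r)%N%:Z))).
      apply: ler_sum => i _; rewrite -real_normK ?num_real// expr2 PoszM.
      by apply: ler_pM.
    by rewrite sumr_const card_ord -mulr_natl natz -PoszM.
  by rewrite -PoszD lez_nat (_ : 3 * r = r + (r + r))%N ?expnD; [nia|lia].
have s0 : 0 <= 1 + \sum_(i < n) w 0 i ^+ 2.
  by apply: addr_ge0 => //; apply: sumr_ge0 => i _; apply: sqr_ge0.
set X := (2 ^ (3 * r))%N in s2.
have -> : (2 ^ (6 * r + 1))%N = (X * X + X * X)%N.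
  rewrite (_ : 6 * r + 1 = 3 * r + 3 * r + 1)%N; last lia.
  by rewrite (expnD 2 _ 1) (expnD 2 (3 * r)) -/X expn1 muln2 -addnn.
by rewrite /base mulr2n PoszD PoszM -expr2; apply: lerD; rewrite lerXn2r ?nnegrE.
Qed.

Lemma word_expn_le P : (word (2 ^ P) <= 2 * (P + 2))%N.
Proof.
rewrite /word leq_mul2l /= addnC addn2 addn1 ltnS; apply: up_log_min => //.
by rewrite expnS mul2n -addnn addn1 -addn1 leq_add// expn_gt0.
Qed.

Lemma weightmem_ok n T K mi B : 0 < B -> B ^+ n <= K%:Z -> (n <= T)%N ->
  memory_ok n K mi -> memory_ok n K (weightmem T mi B n).
Proof.
move=> B0 BK nT [mK m01]; split=> a.
  rewrite /weightmem; case: ifP => // /andP[Ta aT]; apply: le_trans BK.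
  have aTn : (a - T < n)%N by lia.
  have -> : `|(mi (a - T)%N *+ 2 - 1) * B ^+ (a - T)| = B ^+ (a - T).
    by rewrite normrM (gtr0_norm (exprn_gt0 _ B0)); case: (m01 _ aTn) => ->;
      rewrite ?mul0rn ?sub0r ?normrN ?mulr2n ?addrK normr1 mul1r.
  by rewrite ler_weXn2l//; lia.
by move=> an; rewrite /weightmem leqNgt (leq_trans an nT); apply: m01.
Qed.

Lemma vec_weightmem n T mi B o : (o + n <= T)%N ->
  vec n (weightmem T mi B n) o = vec n mi o.
Proof.
move=> oT; apply/rowP => i; rewrite !mxE /weightmem leqNgt.
by rewrite (leq_trans _ oT)// ltn_add2l.
Qed.

Lemma vec_weightmem_top n T mi B :
  vec n (weightmem T mi B n) T = weights (vec n mi 0) B.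
Proof.
by apply/rowP => i; rewrite !mxE /weightmem leq_addr ltn_add2l ltn_ord addKn add0n.
Qed.

Theorem theorem3p4 (R : realType) :
  exists (p : program) (T A : {poly nat}),
  forall (n : nat) (S : set 'rV[int]_n) (x w : 'rV[int]_n) (E : seq 'rV[int]_n),
    S `<=` zero_one n ->
    S x ->
    uniq E ->
    covers_edge_directions (conv_hull (embed R @` S)) E ->
    exists c : config,
      [/\ halts_in S p (initial x w E) c,
          exists2 y : 'rV[int]_n, outputs c y & optimal S w y,
          (time c <= T.[right_length x w E])%N &
          (nops c <= A.[left_length E])%N].
Proof.
pose prog := weights_prog ;; pivot_loop.
(* Its value at r is 2 (P + 2), a bound on the length of a number when N = 2^P with the P chosen
   below. *)
pose wordP : {poly nat} :=
  2%N%:P * (2%N%:P * ((6%N%:P * 'X + 1%N%:P) * ('X + 1%N%:P)) + 'X + 4%N%:P).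
exists (compile 0 prog), (step_bound ('X + 2%N%:P) * (('X + 3%N%:P) * wordP + 1%N%:P)), (step_bound 'X).
move=> n S x w E S01 Sx uE covE.
set r := right_length x w E; pose M := size E.
(* From B <= 2^(6r + 1) and n <= r, K = 2^Q bounds B^n and all stored numbers. Then N = 4 * 2^r *
   K^2 leaves room for squares and for sums of n terms. *)
pose Q := ((6 * r + 1) * (r + 1))%N; pose K := (2 ^ Q)%N.
pose P := (2 * Q + r + 2)%N; pose N := (2 ^ P)%N.
pose T := (2 * n + M * n)%N; pose B := base w.
pose mi a := nth 0 (input x w E) a.
have Tr : (T <= r)%N by apply: right_length_ge.
have Mr : (M <= r.+1)%N by apply: size_le_right_length.
have nr : (n <= r)%N by lia.
have A1 : (r < 2 ^ r)%N by apply: ltn_expl.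
have K2 : (1 < K)%N by rewrite /K -{1}(expn0 2) ltn_exp2l// /Q; nia.
have NE : N = (K * K * 2 ^ r * 4)%N by rewrite /N /P (expnD 2 _ 2) (expnD 2 (2 * Q)) mul2n -addnn (expnD 2 Q).
have KN : (K * K + n * K + K + 2 <= N)%N by rewrite NE; nia.
have KN' : (K <= N)%N by lia.
have TN : (T + n <= N)%N by rewrite NE; nia.
have N0 : (0 < N)%N by lia.
have rK : (2 ^ r <= K)%N by rewrite leq_exp2l// /Q; nia.
have miK a : `|mi a| <= K%:Z.
  by apply: le_trans (input_bound x w E a) _; rewrite lez_nat.
have x01 := S01 _ Sx.
have m01 a : (a < n)%N -> mi a = 0 \/ mi a = 1.
  move=> an; have /rowP/(_ (Ordinal an)) := vec_input_x x w E.
  by rewrite mxE add0n /= => xa; rewrite /mi xa; apply: x01.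
have B0 : 0 < B.
  by rewrite /B /base pmulrn_lgt0// exprn_gt0// ltr_wpDr// sumr_ge0// => i _; apply: sqr_ge0.
have BQ : B <= (2 ^ (6 * r + 1))%N%:Z.
  apply: base_bound => // i; have := input_bound x w E (n + i).
  by have /rowP/(_ i) := vec_input_w x w E; rewrite mxE => ->.
have BK : B <= K%:Z by apply: le_trans BQ _; rewrite lez_nat leq_exp2l// /Q; nia.
have BnK : B ^+ n <= K%:Z.
  apply: (@le_trans _ _ ((2 ^ (6 * r + 1))%N%:Z ^+ n)).
    by rewrite lerXn2r// nnegrE ?ltW.
  by rewrite -[X in X ^+ _]natz -natrX natz lez_nat -expnM leq_exp2l// /Q; nia.
have w_input : vec n mi n = w by apply: vec_input_w.
have wpp : wp S (word N) prog (16 * n + 14 + (M.+1 * (M * (n * 42 + 34) + n * 21 + 14) + 2))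
    (fun r' m' => exists2 mi', holds m' mi' & optimal S w (vec n mi' 0))
    (regs (initial x w E)) (memory (initial x w E)).
  apply: (wp_seq (leqnn _)).
  apply: wp_post; last first.
    apply: (@weights_wp n S N T M N0 TN _ mi) => //; rewrite ?w_input.
    - by move=> a; apply: le_trans (miK a) _; rewrite lez_nat.
    - by apply: le_trans BK _; rewrite lez_nat.
    - by apply: le_trans BnK _; rewrite lez_nat.
    - by lia.
  rewrite w_input => r1 m1 [re r5 mE].
  have w_after : vec n (weightmem T mi B n) n = w by rewrite vec_weightmem ?w_input//; lia.
  have x_after : vec n (weightmem T mi B n) 0 = x.
    by rewrite vec_weightmem ?vec_input_x//; lia.
  have := @pivot_loop_wp n S N T K M N0 TN (erefl _) R E x (weightmem T mi B n) r1 m1 KN.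
  rewrite w_after x_after; apply=> //; first lia.
  - move=> k kM; rewrite vec_weightmem ?vec_input_E//.
    have : (k.+1 * n <= M * n)%N by rewrite leq_mul2r kM orbT.
    by lia.
  - by rewrite vec_weightmem_top vec_input_x.
  - exact: pivot_state_init.
  - by apply: weightmem_ok => //; lia.
have br : bounded (word N) (regs (initial x w E)).
  move=> a /=; apply: (@rat_length_int _ (nth 0%N [:: n; size E] a)%:Z) => //.
  rewrite -/M; case: a => [|[|a]] /=; rewrite ?nth_nil; [lia| |lia].
  by rewrite NE; nia.
have bm : bounded (word N) (memory (initial x w E)).
  move=> a; apply: rat_length_int => //; apply: le_trans (miK a) _.
  by rewrite lez_nat.
have [j [c [runc jle pcc tc [qc [_ _ [mi' mE opt]]]]]] := wpp br bm [::] [::] 0%N 0%N.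
exists c; split.
- by exists j; [rewrite cats0 in runc|rewrite /halted size_compile pcc].
- exists (vec n mi' 0) => //; apply/rowP => i.
  by rewrite !mxE mE add0n.
- apply: leq_trans tc _; rewrite add0n hornerM; apply: leq_mul.
    apply: leq_trans jle _; rewrite step_boundE hornerD hornerX hornerC.
    by apply: (@steps_le n M (r + 2)%N); lia.
  have wordPE : wordP.[r] = (2 * (P + 2))%N.
    by rewrite !(hornerD, hornerM, hornerX, hornerC) /P /Q -(addnA _ 2%N 2%N).
  rewrite hornerD hornerM hornerD hornerX !hornerC wordPE /step_cost.
  by rewrite leq_add2r leq_mul ?leq_add2r// word_expn_le.
apply: leq_trans qc _; rewrite step_boundE hornerX /left_length /unary_length add0n.
by apply: leq_trans jle _; apply: steps_le; lia.
Qed.
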